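(* Let $m$ be a good product of $r$ primes. For every symmetric Boolean function $f$ on $n$ inputs and every depth $d \ge 4$ with $d \equiv 1 \pmod 3$, there exists an $\mathsf{AC}^0[m]$ circuit of depth $d$ and size $\exp(\tilde{O}(n^{3/((r+3)(d-1)-3)}))$ computing $f$.
   Context: A product $m$ of distinct primes $q_1,\ldots,q_r$ is called good if every prime factor of $\phi(m)$ (Euler's totient) divides $m$; e.g. the product of the first $r$ primes is good. A Boolean function is symmetric if its value depends only on the number of ones in the input. An $\mathsf{AC}^0[m]$ circuit is a circuit with unbounded fan-in AND, OR, NOT and $\text{MOD}_m$ gates, where a $\text{MOD}_m$ gate outputs $1$ iff the sum of its inputs (counted with wire multiplicity) is divisible by $m$. Size is the number of gates. $\tilde{O}(\cdot)$ hides polylogarithmic factors in $n$; constants may depend on $m$ and $d$, with $n\to\infty$. *)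

(* Defs.v *)
From mathcomp Require Import all_boot all_order all_algebra.
From mathcomp Require Import all_classical all_reals all_analysis.

Set Implicit Arguments.
Unset Strict Implicit.
Unset Printing Implicit Defensive.

Import Order.TTheory GRing.Theory Num.Theory.
Import numFieldNormedType.Exports.

Definition good (m : nat) : Prop :=
  forall p, prime p -> p %| totient m -> p %| m.

Definition symmetric_bool (n : nat) (f : n.-tuple bool -> bool) : Prop :=
  forall x y : n.-tuple bool, count id x = count id y -> f x = f y.

(* In a circuit on n inputs the nodes are numbered topologically: node i < n is
   the i-th input and node n + j is the j-th gate. A gate lists the nodes its
   input wires come from; a node repeated in the list is a multiple wire. *)
Inductive gate :=
  | AndGate of seq nat
  | OrGate of seq nat
  | NotGate of nat
  | ModGate of seq nat.

Definition wires (g : gate) : seq nat :=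
  match g with
  | AndGate ws | OrGate ws | ModGate ws => ws
  | NotGate w => [:: w]
  end.

Fixpoint wf_gates (k : nat) (gs : seq gate) : bool :=
  if gs is g :: gs' then all (fun w => w < k) (wires g) && wf_gates k.+1 gs'
  else true.

Record circuit (n : nat) := Circuit {
  gates : seq gate;
  output : nat;
  _ : wf_gates n gates;
  _ : output < n + size gates }.

Definition gate_value (m : nat) (v : seq bool) (g : gate) : bool :=
  match g with
  | AndGate ws => all (nth false v) ws
  | OrGate ws => has (nth false v) ws
  | NotGate w => ~~ nth false v w
  | ModGate ws => m %| \sum_(w <- ws) nth false v w
  end.

Definition node_values (m n : nat) (C : circuit n) (x : n.-tuple bool)
    : seq bool :=
  foldl (fun v g => rcons v (gate_value m v g)) x (gates C).

Definition circuit_eval (m n : nat) (C : circuit n) (x : n.-tuple bool)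
    : bool :=
  nth false (node_values m C x) (output C).

Definition computes (m n : nat) (C : circuit n) (f : n.-tuple bool -> bool)
    : Prop :=
  forall x, circuit_eval m C x = f x.

Definition circuit_size (n : nat) (C : circuit n) : nat := size (gates C).

(* Every gate counts towards the depth, NOT gates included. *)
Definition gate_depth (ds : seq nat) (g : gate) : nat :=
  (\max_(w <- wires g) nth 0 ds w).+1.

Definition node_depths (n : nat) (C : circuit n) : seq nat :=
  foldl (fun ds g => rcons ds (gate_depth ds g)) (nseq n 0) (gates C).

Definition circuit_depth (n : nat) (C : circuit n) : nat :=
  nth 0 (node_depths C) (output C).

Local Open Scope classical_set_scope.
Local Open Scope ring_scope.

Definition soft_bigO (R : realType) (g h : nat -> R) : Prop :=
  exists k : nat,
    (g : nat -> R^o) =O_\oo ((fun n => h n * ln n%:R ^+ k) : nat -> R^o).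

(* Main.v *)
Require Import Defs.
From mathcomp Require Import all_boot all_order all_algebra.
From mathcomp Require Import all_classical all_reals all_analysis.
From mathcomp Require Import zify ring lra.

Set Implicit Arguments.
Unset Strict Implicit.
Unset Printing Implicit Defensive.
Import Order.TTheory GRing.Theory Num.Theory.

(* Write d = 3 l + 1, E = (r + 3) l - 1, and let B be about n^(1/E). The inputs are split into B
   blocks; the top OR guesses the sum of every block and an AND verifies all the guesses, so it
   remains to test [S = s] for a block sum S by an AND of depth-(3 l - 1) circuits of size
   exp(~O(B)). Two facts about S are checked.

   (1) S modulo M = prod_p p^(a_p l), where p^(a_p) <= B < p^(a_p + 1) for each prime p | m, so
   that M is about B^(r l). By Lucas, S mod p^(a l) is determined by the binomials C(S, p^j) mod p
   for j < a l. These are row sums of the p^j-th power of a matrix over F_p, and raising to a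
   power at most B expands into MOD_p of ANDs of fan-in at most B, so 2 l layers are enough.

   (2) S up to an error less than M. A random formula made of 3 l - 2 layers of NORs, pushed into
   alternating ANDs and ORs of positive inputs, multiplies the log-ratio of the acceptance
   probabilities of the two sides of the gap by about B in each layer; probabilities evolve as
   p -> (1 - p)^K. One more OR and a union bound over the 2^n inputs give a worst-case gap test
   AND_(n+1) OR_K. Its negation, needed for the upper bound on S, is not allowed an extra layer:
   the OR over n + 1 copies joins the top guess, and a NOR of K functions is an AND of n + 1
   MOD_m gates applied to well-chosen subsets of them.

   Since block sums differing by less than M and congruent modulo M are equal, the test is exact;
   the width condition is n / B <= B^(3 l - 2) M up to logarithmic and constant factors. *)

(** * Layered formulas *)

Notation bfun n := {ffun n.-tuple bool -> bool}.

(** Formulas are represented by the functions they compute, so equality is extensional. Leaves are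
    positive inputs and there is no NOT, which would cost a layer; repetitions in [Gs] act as
    multiple wires of a MOD gate. *)
Fixpoint layered (m W n k : nat) (F : bfun n) : Prop :=
  if k is k'.+1 then
    exists Gs : seq (bfun n),
      [/\ size Gs <= W, {in Gs, forall G, layered m W k' G} &
        [\/ F = [ffun x => all (fun G : bfun n => G x) Gs],
            F = [ffun x => has (fun G : bfun n => G x) Gs] |
            F = [ffun x => m %| \sum_(G <- Gs) (G x : bool)]]]
  else exists i : 'I_n, F = [ffun x => tnth x i].

Section Layered.
Variables (m W n : nat).
Implicit Types (F G : bfun n) (Gs : seq (bfun n)) (gs hs : seq gate).

Lemma layeredS k F : 0 < W -> layered m W k F -> layered m W k.+1 F.
Proof.
move=> W0 HF; exists [:: F]; split => //.
  by move=> G; rewrite inE => /eqP ->.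
by constructor 1; apply/ffunP => x; rewrite ffunE /= andbT.
Qed.

Lemma layered_le k k' F :
  0 < W -> k <= k' -> layered m W k F -> layered m W k' F.
Proof.
move=> W0 /subnK <-; elim: (k' - k) => //= j IH HF.
by apply: layeredS => //; apply: IH.
Qed.

Lemma layered_and k Gs :
  size Gs <= W -> {in Gs, forall G, layered m W k G} ->
  layered m W k.+1 [ffun x => all (fun G : bfun n => G x) Gs].
Proof. by move=> sG HG; exists Gs; split => //; constructor 1. Qed.

Lemma layered_or k Gs :
  size Gs <= W -> {in Gs, forall G, layered m W k G} ->
  layered m W k.+1 [ffun x => has (fun G : bfun n => G x) Gs].
Proof. by move=> sG HG; exists Gs; split => //; constructor 2. Qed.

Lemma layered_mod k Gs :
  size Gs <= W -> {in Gs, forall G, layered m W k G} ->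
  layered m W k.+1 [ffun x => m %| \sum_(G <- Gs) (G x : bool)].
Proof. by move=> sG HG; exists Gs; split => //; constructor 3. Qed.

Let vals gs (x : n.-tuple bool) : seq bool :=
  foldl (fun v g => rcons v (gate_value m v g)) x gs.
Let deps gs : seq nat :=
  foldl (fun ds g => rcons ds (gate_depth ds g)) (nseq n 0) gs.

Lemma vals_rcons gs g x :
  vals (rcons gs g) x = rcons (vals gs x) (gate_value m (vals gs x) g).
Proof. by rewrite /vals -cats1 foldl_cat. Qed.

Lemma deps_rcons gs g :
  deps (rcons gs g) = rcons (deps gs) (gate_depth (deps gs) g).
Proof. by rewrite /deps -cats1 foldl_cat. Qed.

Lemma size_vals gs x : size (vals gs x) = n + size gs.
Proof.
elim/last_ind: gs => [|gs g IH]; first by rewrite /vals /= size_tuple addn0.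
by rewrite vals_rcons !size_rcons IH addnS.
Qed.

Lemma size_deps gs : size (deps gs) = n + size gs.
Proof.
elim/last_ind: gs => [|gs g IH]; first by rewrite /deps /= size_nseq addn0.
by rewrite deps_rcons !size_rcons IH addnS.
Qed.

Lemma nth_vals_cat gs hs x w : w < n + size gs ->
  nth false (vals (gs ++ hs) x) w = nth false (vals gs x) w.
Proof.
elim/last_ind: hs => [|hs h IH] lt_w; first by rewrite cats0.
rewrite -rcons_cat vals_rcons nth_rcons size_vals size_cat.
by rewrite (leq_trans lt_w) ?IH// leq_add2l leq_addr.
Qed.

Lemma nth_deps_cat gs hs w : w < n + size gs ->
  nth 0 (deps (gs ++ hs)) w = nth 0 (deps gs) w.
Proof.
elim/last_ind: hs => [|hs h IH] lt_w; first by rewrite cats0.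
rewrite -rcons_cat deps_rcons nth_rcons size_deps size_cat.
by rewrite (leq_trans lt_w) ?IH// leq_add2l leq_addr.
Qed.

Lemma wf_gates_rcons k gs g : wf_gates k (rcons gs g) =
  wf_gates k gs && all (fun w => w < k + size gs) (wires g).
Proof.
elim: gs k => [|h gs IH] k /=; first by rewrite addn0 andbT.
by rewrite IH addSnnS andbA.
Qed.

Let node_for gs w k F :=
  [/\ w < n + size gs, forall x, nth false (vals gs x) w = F x &
      nth 0 (deps gs) w <= k].

Lemma node_for_cat gs hs w k F :
  node_for gs w k F -> node_for (gs ++ hs) w k F.
Proof.
case=> lt_w vw dw; split.
- by rewrite (leq_trans lt_w)// leq_add2l size_cat leq_addr.
- by move=> x; rewrite nth_vals_cat.
- by rewrite nth_deps_cat.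
Qed.

Fixpoint layered_size (k : nat) : nat :=
  if k is k'.+1 then (W * layered_size k').+1 else 0.

(** The gates of [F] are appended to an arbitrary list [gs]: earlier nodes keep their values and
    depths, so the subformulas can be laid out one after another without sharing. *)
Lemma layered_nodes k gs F : layered m W k F -> wf_gates n gs ->
  exists hs w, [/\ wf_gates n (gs ++ hs), size hs <= layered_size k &
                   node_for (gs ++ hs) w k F].
Proof.
elim: k gs F => [|k IH] gs F /=.
  case=> i -> wf_gs; exists [::], (val i); rewrite cats0; split => //.
  have lt_i0 : i < n + size ([::] : seq gate) by rewrite addn0.
  split=> [|x|]; first exact: (ltn_addr (size gs) (ltn_ord i)).
    by rewrite (nth_vals_cat gs x lt_i0) ffunE (tnth_nth false).
  by rewrite (nth_deps_cat gs lt_i0) /deps /= nth_nseq ltn_ord.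
case=> Gs [sGs HGs FE] wf_gs.
have [hs [ws [wf_h s_h s_w Hws]]] : exists hs ws,
    [/\ wf_gates n (gs ++ hs), size hs <= size Gs * layered_size k,
        size ws = size Gs &
        forall i, i < size Gs ->
          node_for (gs ++ hs) (nth 0 ws i) k (nth [ffun => false] Gs i)].
  elim: Gs HGs {FE sGs} => [|G Gs IHG] HGs.
    by exists [::], [::]; rewrite cats0.
  have [|hs [ws [wf_h s_h s_w Hws]]] := IHG.
    by move=> H HH; apply: HGs; rewrite inE HH orbT.
  have [|hs' [w [wf' s' Hw]]] := IH (gs ++ hs) G _ wf_h.
    by apply: HGs; rewrite mem_head.
  exists (hs ++ hs'), (w :: ws); rewrite catA; split => //=.
  - by rewrite size_cat mulSn addnC leq_add.
  - by rewrite s_w.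
  - by case=> [|i] //= /Hws; apply: node_for_cat.
have lt_ws : all (fun w => w < n + size (gs ++ hs)) ws.
  by apply/(all_nthP 0) => i; rewrite s_w => /Hws [].
have valE x : map (nth false (vals (gs ++ hs) x)) ws
            = map (fun G : bfun n => G x) Gs.
  apply: (@eq_from_nth _ false); rewrite !size_map // => i lt_i.
  rewrite (nth_map 0)// (nth_map [ffun => false]) -?s_w//.
  by rewrite s_w in lt_i; case: (Hws _ lt_i).
have [g gws gval] : exists2 g, wires g = ws &
    forall x, gate_value m (vals (gs ++ hs) x) g = F x.
  case: FE => ->.
  - exists (AndGate ws) => // x; rewrite ffunE /=.
    by have := congr1 (all id) (valE x); rewrite !all_map.
  - exists (OrGate ws) => // x; rewrite ffunE /=.
    by have := congr1 (has id) (valE x); rewrite !has_map.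
  - exists (ModGate ws) => // x; rewrite ffunE /=.
    have := congr1 (fun s => \sum_(b <- s) nat_of_bool b) (valE x).
    by rewrite !big_map => ->.
exists (rcons hs g), (n + size (gs ++ hs)); rewrite -rcons_cat; split.
- by rewrite wf_gates_rcons wf_h gws.
- by rewrite size_rcons ltnS (leq_trans s_h)// leq_mul.
split=> [|x|].
- by rewrite size_rcons addnS.
- by rewrite vals_rcons nth_rcons size_vals ltnn eqxx gval.
- rewrite deps_rcons nth_rcons size_deps ltnn eqxx /gate_depth ltnS gws.
  apply/bigmax_leqP_seq => w /(nthP 0) [i lt_i <-] _.
  by rewrite s_w in lt_i; case: (Hws _ lt_i).
Qed.

Lemma layered_circuit d F : 0 < W -> layered m W d F -> 0 < d ->
  exists C : circuit n,
    [/\ circuit_depth C = d, computes m C F &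
        circuit_size C <= layered_size d + d].
Proof.
move=> W0 HF d0.
have [gs [w [/= wf_gs s_gs [lt_w vw dw]]]] := layered_nodes HF (isT : wf_gates n [::]).
(* The root may have depth below [d], since a gate without wires has depth 1 in whatever layer it
   stands. A chain of one-input ANDs makes up the difference. *)
have [j [gs' [w' [wf' s' lt_w' v' d']]]] : exists j gs' w',
  [/\ wf_gates n gs', size gs' = size gs + (d - nth 0 (deps gs) w) ,
      w' < n + size gs', forall x, nth false (vals gs' x) w' = F x &
      nth 0 (deps gs') w' = d /\ j = 0].
  exists 0; have := subnKC dw; move: (d - _) => j.
  elim: j d {HF d0 s_gs dw} => [|j IH] e de.
    by exists gs, w; split; rewrite ?addn0//; split => //; rewrite -de addn0.
  have [gs' [w' [wf' s' lt_w' v' [d' _]]]] := IH _ erefl.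
  exists (rcons gs' (AndGate [:: w'])), (n + size gs'); split.
  - by rewrite wf_gates_rcons wf' /= lt_w'.
  - by rewrite size_rcons s' addnS.
  - by rewrite size_rcons addnS.
  - by move=> x; rewrite vals_rcons nth_rcons size_vals ltnn eqxx /= andbT.
  - rewrite deps_rcons nth_rcons size_deps ltnn eqxx /gate_depth /= big_seq1.
    by rewrite d' -de addnS.
exists (Circuit wf' lt_w'); split.
- by case: d'.
- by move=> x; rewrite /circuit_eval /node_values v'.
- by rewrite /circuit_size /= s' leq_add// leq_subr.
Qed.

End Layered.

(** * Disjunctions of conjunctions *)

Section Dnf.
Variables (m W n : nat).
Implicit Types (F G : bfun n).

(** The two top layers are kept apart from the depth-[k] literals: conjunctions then distribute and
    disjunctions concatenate without adding layers, at a cost in [N] and [w] only. *)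
Definition dnf (k N w : nat) (F : bfun n) : Prop :=
  exists Ts : seq (seq (bfun n)),
    [/\ size Ts <= N,
        {in Ts, forall t, size t <= w /\ {in t, forall G, layered m W k G}} &
        F = [ffun x => has (all (fun G : bfun n => G x)) Ts]].

Lemma dnf_layered k N w F :
  N <= W -> w <= W -> dnf k N w F -> layered m W k.+2 F.
Proof.
move=> NW wW [Ts [sT HT ->]].
pose conj (t : seq (bfun n)) : bfun n :=
  [ffun x => all (fun G : bfun n => G x) t].
have -> : [ffun x => has (all (fun G : bfun n => G x)) Ts]
        = [ffun x => has (fun G : bfun n => G x) (map conj Ts)].
  apply/ffunP => x; rewrite !ffunE has_map; apply: eq_has => t /=.
  by rewrite ffunE.
apply: layered_or; first by rewrite size_map (leq_trans sT).
move=> _ /mapP [t tT ->]; have [st Ht] := HT _ tT.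
by apply: layered_and => //; apply: leq_trans st wW.
Qed.

Lemma dnf_true k N w : 0 < N -> dnf k N w [ffun => true].
Proof.
move=> N0; exists [:: [::]]; split => //.
  by move=> t; rewrite inE => /eqP ->.
Qed.

Lemma dnf_false k N w : dnf k N w [ffun => false].
Proof. by exists [::]; split => //; apply/ffunP => x; rewrite !ffunE. Qed.

Lemma dnf_and k N1 N2 w1 w2 F1 F2 : dnf k N1 w1 F1 -> dnf k N2 w2 F2 ->
  dnf k (N1 * N2) (w1 + w2) [ffun x => F1 x && F2 x].
Proof.
move=> [T1 [s1 H1 ->]] [T2 [s2 H2 ->]].
exists [seq t1 ++ t2 | t1 <- T1, t2 <- T2]; split.
- by rewrite size_allpairs leq_mul.
- move=> _ /allpairsP [[t1 t2] /= [i1 i2 ->]].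
  have [h1 h1'] := H1 _ i1; have [h2 h2'] := H2 _ i2.
  split; first by rewrite size_cat leq_add.
  by move=> G; rewrite mem_cat => /orP [/h1' | /h2'].
- apply/ffunP => x; rewrite !ffunE; apply/andP/hasP.
    move=> [/hasP [t1 i1 a1] /hasP [t2 i2 a2]]; exists (t1 ++ t2).
      by apply/allpairsP; exists (t1, t2).
    by rewrite all_cat a1.
  move=> [_ /allpairsP [[t1 t2] /= [i1 i2 ->]]]; rewrite all_cat => /andP [a1 a2].
  by split; apply/hasP; [exists t1 | exists t2].
Qed.

Lemma dnf_or (I : eqType) k N w (Fs : I -> bfun n) (s : seq I) :
  {in s, forall i, dnf k N w (Fs i)} ->
  dnf k (size s * N) w [ffun x => has (fun i => Fs i x) s].
Proof.
elim: s => [|i s IH] H.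
  by exists [::]; split => //; apply/ffunP => x; rewrite !ffunE.
have [T1 [s1 H1 E1]] := H i (mem_head _ _).
have [|T2 [s2 H2 E2]] := IH; first by move=> j js; apply: H; rewrite inE js orbT.
exists (T1 ++ T2); split.
- by rewrite size_cat mulSn leq_add.
- by move=> t; rewrite mem_cat => /orP [/H1 | /H2].
- apply/ffunP => x; rewrite !ffunE /= has_cat E1 ffunE.
  by have /ffunP /(_ x) := E2; rewrite !ffunE => ->.
Qed.

End Dnf.

(** * Small hitting lists by averaging *)

(** Double counting: each member of [A] is hit by at least half of [P], so some sample hits at least
    half of [A]. Removing what it hits halves the bound, and after [k] rounds nothing is left. *)
Lemma hitting_list (O X : finType) (P : {set O}) (hit : O -> X -> bool)
    (k : nat) (A : {set X}) :
  0 < #|P| -> #|A| < 2 ^ k ->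
  {in A, forall x, #|P| <= 2 * #|[set w in P | hit w x]|} ->
  exists s : seq O,
    [/\ size s <= k, {subset s <= P} & {in A, forall x, has (hit^~ x) s}].
Proof.
move=> P0; elim: k A => [|k IH] A.
  rewrite expn0 ltnS leqn0 cards_eq0 => /eqP -> _.
  by exists [::]; split => // x; rewrite inE.
move=> sA HA.
have [w wP hw] : exists2 w, w \in P & #|A| <= 2 * #|[set x in A | hit w x]|.
  case: (boolP [exists w in P, #|A| <= 2 * #|[set x in A | hit w x]|]).
    by move=> /existsP [w /andP [wP hw]]; exists w.
  rewrite negb_exists => /forallP no.
  have lt1 : \sum_(w in P) (2 * #|[set x in A | hit w x]|).+1
             <= \sum_(w in P) #|A|.
    apply: leq_sum => w wP; rewrite ltnNge.
    by have := no w; rewrite wP.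
  have swap : \sum_(w in P) #|[set x in A | hit w x]|
            = \sum_(x in A) #|[set w in P | hit w x]|.
    transitivity (\sum_(w in P) \sum_(x in A) hit w x).
      apply: eq_bigr => w _; rewrite -sum1_card big_mkcond /= [RHS]big_mkcond /=.
      by apply: eq_bigr => x _; rewrite inE; case: (x \in A); case: (hit w x).
    rewrite exchange_big /=; apply: eq_bigr => x _.
    rewrite -sum1_card [RHS]big_mkcond /= big_mkcond /=.
    by apply: eq_bigr => w _; rewrite inE; case: (w \in P); case: (hit w x).
  have le2 : \sum_(x in A) #|P| <= \sum_(w in P) 2 * #|[set x in A | hit w x]|.
    by rewrite -big_distrr /= swap big_distrr /=; apply: leq_sum.
  exfalso; move: lt1; rewrite sum_nat_const.
  under eq_bigr do rewrite -addn1.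
  rewrite big_split /= sum1_card leqNgt => /negP; apply.
  rewrite sum_nat_const mulnC in le2.
  by rewrite -addn1 leq_add.
have [||s [ss sP Hs]] := IH (A :\: [set x in A | hit w x]).
- have sub : [set x in A | hit w x] \subset A.
    by apply/fintype.subsetP => x; rewrite inE => /andP [].
  have := cardsID [set x in A | hit w x] A.
  rewrite (finset.setIidPr sub) => e; rewrite expnS in sA.
  by rewrite -(ltn_pmul2l (isT : 0 < 2)); move: sA hw e; lia.
- by move=> x; rewrite !inE => /andP [_ /HA].
exists (w :: s); split => //=.
- by move=> v; rewrite inE => /predU1P [->|/sP].
- move=> x xA; case: (boolP (hit w x)) => //= nh; apply: Hs.
  by rewrite !inE xA nh.
Qed.

(* Random subset sums modulo m: if some [G] in the list accepts, then toggling it pairs every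
   subset whose sum vanishes with one whose sum does not. *)
Lemma nor_and_mod (m n : nat) (Gs : seq (bfun n)) : 1 < m ->
  exists Hs : seq (seq (bfun n)),
    [/\ size Hs <= n.+1,
        {in Hs, forall H, size H <= size Gs /\ {subset H <= Gs}} &
        forall x, ~~ has (fun G : bfun n => G x) Gs =
          all (fun H => m %| \sum_(G <- H) ((G : bfun n) x : bool)) Hs].
Proof.
move=> m1; pose K := size Gs; pose g (i : 'I_K) := nth [ffun=> false] Gs i.
pose hit (s : {set 'I_K}) (x : n.-tuple bool) :=
  ~~ (m %| \sum_(i in s) (g i x : bool)).
have [|||L [sL _ HL]] := @hitting_list _ _ [set: {set 'I_K}] hit n.+1
    [set x | has (fun G : bfun n => G x) Gs].
- by apply/card_gt0P; exists finset.set0; rewrite finset.in_setT.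
- rewrite (leq_ltn_trans (max_card _))// card_tuple card_bool ltn_exp2l//.
- move=> x; rewrite inE => /(has_nthP [ffun=> false]) [i lt_i gi].
  pose j := Ordinal lt_i.
  pose tog (s : {set 'I_K}) := if j \in s then s :\ j else j |: s.
  have togK : involutive tog.
    move=> s; rewrite /tog; case: (boolP (j \in s)) => js.
      by rewrite finset.setD11 finset.setD1K.
    by rewrite finset.setU11 finset.setU1K.
  have sum_tog (s : {set 'I_K}) : j \notin s ->
      \sum_(i in tog s) (g i x : bool) = (\sum_(i in s) (g i x : bool)).+1.
    move=> js; rewrite /tog (negbTE js) big_setU1//=.
    by rewrite {1}/g /= gi.
  set H := [set s in _ | _].
  have sub : [set tog s | s in ~: H] \subset H.
    apply/fintype.subsetP => _ /imsetP [s sH ->].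
    move: sH; rewrite !inE /= /hit negbK => ds.
    apply/negP => dt.
    have [s' [d1 d2]] : exists s' : {set 'I_K}, m %| \sum_(i in s') (g i x : bool) /\
         m %| (\sum_(i in s') (g i x : bool)).+1.
      case: (boolP (j \in s)) => js.
        exists (tog s); split => //; rewrite -sum_tog ?togK//.
        by rewrite /tog js finset.setD11.
      by exists s; split => //; rewrite -sum_tog.
    by move: d2; rewrite -addn1 dvdn_addr// dvdn1 => /eqP m_eq; rewrite m_eq in m1.
  rewrite cardsT mul2n -addnn -(cardsC H) leq_add2l.
  by rewrite -(card_imset _ (can_inj togK)) subset_leq_card.
pose sub_g (s : {set 'I_K}) := [seq g i | i <- enum s].
exists (map sub_g L); split.
- by rewrite size_map.
- move=> _ /mapP [s _ ->]; split.
    by rewrite size_map -cardE (leq_trans (max_card _))// card_ord.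
  by move=> _ /mapP [i _ ->]; rewrite /g mem_nth.
- move=> x; rewrite all_map.
  case: (boolP (has _ _)) => hx /=.
    have /hasP [s sL' hs] : has (hit^~ x) L by apply: HL; rewrite inE.
    apply/esym/negbTE/allPn; exists s => //=.
    by move: hs; rewrite /hit big_map big_enum.
  apply/esym/allP => s _ /=; rewrite big_map big_enum /= big1// => i _.
  by move: hx => /hasPn /(_ (g i)); rewrite mem_nth// => /(_ isT) /negbTE ->.
Qed.

(** * Binomials and residues modulo prime powers *)

Section Binomial.
Local Open Scope ring_scope.
Variables (q : nat) (q_pr : prime q).

Lemma coef_X1_exp (S i : nat) : (('X + 1) ^+ S : {poly 'F_q})`_i = 'C(S, i)%:R.
Proof.
elim: S i => [|S IH] i.
  by rewrite expr0 coef1 bin0n; case: i.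
rewrite exprS mulrDl mul1r coefD coefXM !IH.
by case: i => [|i]; rewrite ?bin0 ?add0r// binS natrD addrC.
Qed.

Lemma expX1_pow (e : nat) : ('X + 1) ^+ (q ^ e)%N = 'X^(q ^ e)%N + 1 :> {poly 'F_q}.
Proof.
have qch : q \in [pchar {poly 'F_q}] by rewrite pchar_poly pchar_Fp.
elim: e => [|e IH]; first by rewrite expn0 expr1.
rewrite expnSr exprM IH -/(pFrobenius_aut qch _) rmorphD rmorph1.
by rewrite /= pFrobenius_autE -exprM.
Qed.

(** For Y = X^(q^e) the remainder is divisible by X^(2 q^e), hence invisible to the coefficient of
    degree q^e. *)
Lemma exp1D_trunc (A : comNzRingType) (Y : A) (u : nat) :
  exists P, (Y + 1) ^+ u = 1 + u%:R * Y + Y ^+ 2 * P.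
Proof.
elim: u => [|u [P IH]]; first by exists 0; rewrite mul0r mulr0 !addr0.
exists (P + P * Y + u%:R); rewrite exprS IH -natr1; ring.
Qed.

(* (X + 1)^(s + q^e u) = (X + 1)^s (X^(q^e) + 1)^u in characteristic q. *)
Lemma bin_pow_digit (e s u : nat) : (s < q ^ e)%N ->
  'C(s + q ^ e * u, q ^ e)%:R = u%:R :> 'F_q.
Proof.
move=> lt_s; rewrite -coef_X1_exp exprD exprM expX1_pow.
have [P ->] := exp1D_trunc ('X^(q ^ e)%N : {poly 'F_q}) u.
set A := ('X + 1) ^+ s; set Z := 'X^(q ^ e)%N.
have -> : A * (1 + u%:R * Z + Z ^+ 2 * P) = A + (A * u%:R) * Z + A * P * Z * Z.
  by ring.
have Q0 : (0 < q ^ e)%N by rewrite expn_gt0 prime_gt0.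
rewrite !coefD /Z !coefMXn ltnn subnn Q0 addr0 /A coef_X1_exp bin_small// add0r.
by rewrite mulr_natr coefMn coef_X1_exp bin0.
Qed.

Local Close Scope ring_scope.

(** Modulo [q], the binomial C(S, q^j) is the j-th base-[q] digit of [S], and the lowest [e] digits
    are equivalent to the residue modulo q^e. The induction adds one digit at a time. *)
Lemma eq_mod_pow_binomials (e S S' : nat) :
  (forall j, j < e -> ('C(S, q ^ j)%:R = 'C(S', q ^ j)%:R :> 'F_q)%R) <->
  S = S' %[mod q ^ e].
Proof.
have digit_eq i : S = S' %[mod q ^ i] ->
    ('C(S, q ^ i)%:R = (S %/ q ^ i)%:R :> 'F_q)%R /\
    ('C(S', q ^ i)%:R = (S' %/ q ^ i)%:R :> 'F_q)%R.
  move=> _; have Q0 : 0 < q ^ i by rewrite expn_gt0 prime_gt0.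
  by split; [rewrite {1}(divn_eq S (q ^ i))|rewrite {1}(divn_eq S' (q ^ i))];
    rewrite addnC mulnC bin_pow_digit ?ltn_mod.
have natF (a b : nat) : (a%:R = b%:R :> 'F_q)%R <-> a = b %[mod q].
  split=> [ab|ab].
    by rewrite -(val_Fp_nat q_pr a) ab val_Fp_nat.
  by rewrite -(Fp_nat_mod q_pr a) ab Fp_nat_mod.
have modS i (s : nat) : s %% q ^ i.+1 = s %% q ^ i + q ^ i * ((s %/ q ^ i) %% q).
  have Q0 : 0 < q ^ i by rewrite expn_gt0 prime_gt0.
  have lt1 : s %% q ^ i < q ^ i by rewrite ltn_mod.
  have lt2 : s %/ q ^ i %% q < q by rewrite ltn_mod prime_gt0.
  have e1 := divn_eq s (q ^ i); have e2 := divn_eq (s %/ q ^ i) q.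
  have -> : s %% q ^ i.+1 =
    (s %/ q ^ i %/ q * q ^ i.+1 + (s %% q ^ i + q ^ i * (s %/ q ^ i %% q)))
      %% q ^ i.+1.
    congr (_ %% _); rewrite {1}e1 {1}e2 expnSr; ring.
  rewrite modnMDl modn_small// expnSr; nia.
elim: e => [|e [IH1 IH2]]; first by rewrite expn0 !modn1.
split=> [H|H].
  have Se : S = S' %[mod q ^ e] by apply: IH1 => j je; apply: H; apply: ltnW.
  have [d1 d2] := digit_eq _ Se.
  have := H e (ltnSn _); rewrite d1 d2 => /natF dd.
  by rewrite !modS Se dd.
have Se : S = S' %[mod q ^ e].
  have dv : q ^ e %| q ^ e.+1 by rewrite dvdn_exp2l.
  by rewrite -(modn_dvdm S dv) -(modn_dvdm S' dv) H.
move=> j; rewrite ltnS leq_eqVlt => /predU1P [->|/IH2]; last by apply.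
have [-> ->] := digit_eq _ Se; apply/natF.
move: H; rewrite !modS Se => /addnI /eqP.
by rewrite eqn_pmul2l ?expn_gt0 ?prime_gt0// => /eqP.
Qed.

End Binomial.

(** * Sums of products over F_q and matrix powers *)

Section SumProd.
Variables (m W n q : nat) (q_pr : prime q) (q_m : q %| m) (m_gt0 : 0 < m).
Implicit Types (v : n.-tuple bool -> 'F_q).

(** The shape read by a MOD gate over ANDs. Coefficients are expressed by repeating terms, and the
    empty product is the constant 1. *)
Definition sumprod (k s b : nat) (v : n.-tuple bool -> 'F_q) : Prop :=
  exists hss : seq (seq (bfun n)),
    [/\ size hss <= s,
        {in hss, forall hs, size hs <= b /\ {in hs, forall h, layered m W k h}} &
        forall x, v x = (\sum_(hs <- hss) (all (fun h : bfun n => h x) hs)%:R)%R].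

Lemma sumprod_le k s s' b b' v :
  s <= s' -> b <= b' -> sumprod k s b v -> sumprod k s' b' v.
Proof.
move=> ss bb [hss [sh Hh E]]; exists hss; split => //.
  exact: leq_trans sh ss.
by move=> hs /Hh [sb Hb]; split => //; apply: leq_trans sb bb.
Qed.

Lemma sumprod_bool k s b (c : bool) : 0 < s -> sumprod k s b (fun=> (c : nat)%:R%R).
Proof.
move=> s0; exists (nseq c [::]); split.
- by rewrite size_nseq; case: c.
- by move=> hs /nseqP [->].
- by move=> x; case: c; rewrite ?big_nil// big_seq1.
Qed.

Lemma sumprod_mul k s1 s2 b1 b2 v1 v2 :
  sumprod k s1 b1 v1 -> sumprod k s2 b2 v2 ->
  sumprod k (s1 * s2) (b1 + b2) (fun x => v1 x * v2 x)%R.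
Proof.
move=> [T1 [s1' H1 E1]] [T2 [s2' H2 E2]].
exists [seq t1 ++ t2 | t1 <- T1, t2 <- T2]; split.
- by rewrite size_allpairs leq_mul.
- move=> _ /allpairsP [[t1 t2] /= [i1 i2 ->]].
  have [h1 h1'] := H1 _ i1; have [h2 h2'] := H2 _ i2.
  split; first by rewrite size_cat leq_add.
  by move=> G; rewrite mem_cat => /orP [/h1' | /h2'].
- move=> x; rewrite E1 E2 big_allpairs_dep/= mulr_suml.
  apply: eq_bigr => t1 _; rewrite mulr_sumr.
  by apply: eq_bigr => t2 _; rewrite all_cat -natrM mulnb.
Qed.

Lemma sumprod_sum (I : Type) (r : seq I) k s b (v : I -> n.-tuple bool -> 'F_q) :
  (forall i, sumprod k s b (v i)) ->
  sumprod k (size r * s) b (fun x => \sum_(i <- r) v i x)%R.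
Proof.
move=> H; elim: r => [|i r [T2 [s2 H2 E2]]].
  by exists [::]; split => // x; rewrite !big_nil.
have [T1 [s1 H1 E1]] := H i; exists (T1 ++ T2); split.
- by rewrite size_cat mulSn leq_add.
- by move=> t; rewrite mem_cat => /orP [/H1 | /H2].
- by move=> x; rewrite big_cons big_cat E1 E2.
Qed.

(** Appending -c copies of the constant 1 turns the test into divisibility of a sum z by [q]. A
    MOD_m gate decides it once each wire is repeated m / q times, since m divides (m / q) z exactly
    when q divides z. *)
Lemma sumprod_test k s b v (c : 'F_q) : b <= W -> m * (s + q) <= W ->
  sumprod k s b v -> layered m W k.+2 [ffun x => v x == c].
Proof.
move=> bW sW [hss [sh Hh E]].
pose conj (t : seq (bfun n)) : bfun n :=
  [ffun x => all (fun G : bfun n => G x) t].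
have [c' c'E] : exists c' : 'F_q, c' = (- c)%R by exists (- c)%R.
pose L := map conj hss ++ nseq c' (conj [::]).
have E' x : ((\sum_(G <- L) (G x : nat))%N%:R = v x - c :> 'F_q)%R.
  rewrite /L big_cat natrD big_map E natr_sum; congr (_ + _)%R.
    by apply: eq_bigr => t _; rewrite ffunE.
  by rewrite big_nseq ffunE /= iter_addn_0 mul1n natr_Zp c'E.
have sc : c' <= q.
  by apply: ltnW; rewrite -{2}(Fp_cast q_pr) ltn_ord.
have -> : [ffun x => v x == c] =
    [ffun x => m %| \sum_(G <- flatten (nseq (m %/ q) L)) (G x : bool)].
  apply/ffunP => x; rewrite !ffunE.
  have -> : \sum_(G <- flatten (nseq (m %/ q) L)) (G x : bool)
          = (m %/ q) * \sum_(G <- L) (G x : bool).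
    elim: (m %/ q) => [|j IH]; first by rewrite big_nil.
    by rewrite /= big_cat IH mulSn.
  have mq0 : 0 < m %/ q by rewrite divn_gt0 ?prime_gt0// dvdn_leq.
  have <- : ((\sum_(G <- L) (G x : nat))%N%:R == 0 :> 'F_q)%R = (v x == c).
    by rewrite E' subr_eq0.
  rewrite -(dvdn_pcharf (pchar_Fp q_pr)) -(dvdn_pmul2l mq0).
  by rewrite (divnK q_m).
apply: layered_mod.
  apply: leq_trans sW; rewrite size_flatten /shape map_nseq sumn_nseq.
  rewrite size_cat size_map size_nseq mulnC leq_mul ?leq_div//.
  by rewrite leq_add.
move=> G /flattenP [_ /nseqP [-> _]]; rewrite mem_cat => /orP [|/nseqP [-> _]].
  move=> /mapP [t tT ->]; have [st Ht] := Hh _ tT.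
  by apply: layered_and => //; apply: leq_trans st bW.
by apply: layered_and.
Qed.

(** Expand v as the sum over c of c [v = c], with the coefficient c realised by c copies; the
    products then have a single factor. *)
Lemma sumprod_of_test k v :
  (forall c, layered m W k [ffun x => v x == c]) -> sumprod k (q * q) 1 v.
Proof.
move=> H; pose P (c : 'F_q) := nseq c [:: [ffun x => v x == c] : bfun n].
have sc (c : 'F_q) : c <= q.
  by apply: ltnW; rewrite -{2}(Fp_cast q_pr) ltn_ord.
exists (flatten (map P (enum 'F_q))); split.
- rewrite size_flatten /shape -map_comp sumnE big_map.
  rewrite big_enum/= (leq_trans (leq_sum _ (fun c _ => _ : _ <= q)))//.
    by move=> c _; rewrite size_nseq.
  by rewrite sum_nat_const card_Fp.
- move=> hs /flattenP [_ /mapP [c _ ->] /nseqP [-> _]]; split => //.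
  by move=> h; rewrite inE => /eqP ->.
- move=> x; rewrite big_flatten big_map big_enum/= (bigD1 (v x))//=.
  rewrite [X in (_ + X)%R]big1 => [|c cv].
    rewrite /P big_nseq /= ffunE eqxx /= addr0 iter_addr_0.
    by rewrite natr_Zp.
  by rewrite /P big_nseq /= ffunE eq_sym (negbTE cv) /= iter_addr_0 mul0rn.
Qed.

Variable (N : nat).
Implicit Types (A B : n.-tuple bool -> 'M['F_q]_N.+1).

Definition sumprod_mx (k s b : nat) (A : n.-tuple bool -> 'M['F_q]_N.+1) : Prop :=
  forall i j, sumprod k s b (fun x => A x i j).

Lemma sumprod_exp k s b A : sumprod_mx k s 1 A ->
  sumprod_mx k ((N.+1 * s) ^ b) b (fun x => A x ^+ b)%R.
Proof.
move=> HA; elim: b => [|b IH] i j.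
  have [hss [sh Hh E]] := @sumprod_bool k 1 0 (i == j) isT.
  by exists hss; split => // x; rewrite expr0 mxE -(E x).
have [hss [sh Hh E]] := sumprod_sum (enum 'I_N.+1)
  (fun l => sumprod_mul (HA i l) (IH l j)).
exists hss; split => //.
  by rewrite expnS -mulnA; rewrite size_enum_ord in sh.
by move=> x; rewrite -E exprS mxE big_enum.
Qed.

(* Every factor q^a <= B of the exponent costs one MOD-of-AND pair of layers, because the
   entries of a B-fold matrix product are sums of N^B products of B entries. *)
Lemma sumprod_exp_pow a (A : n.-tuple bool -> 'M['F_q]_N.+1) :
  sumprod_mx 0 1 1 A -> q ^ a <= W ->
  m * ((N.+1 * (q * q)) ^ (q ^ a) + q) <= W ->
  forall k j, j <= a * k.+1 ->
  sumprod_mx k.*2 ((N.+1 * (q * q)) ^ (q ^ a)) (q ^ a) (fun x => A x ^+ (q ^ j)%N)%R.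
Proof.
move=> HA bW sW; have q0 := prime_gt0 q_pr.
have Q0 : 0 < N.+1 * (q * q) by rewrite muln_gt0 muln_gt0 q0.
elim=> [|k IH] j.
  rewrite muln1 => ja i l.
  apply: sumprod_le (sumprod_exp (q ^ j) HA i l); last by rewrite leq_pexp2l.
  rewrite (leq_trans (_ : _ <= (N.+1 * (q * q)) ^ (q ^ j)))//.
    by rewrite leq_exp2r ?expn_gt0 ?q0// leq_mul// muln_gt0 q0.
  by rewrite leq_pexp2l// leq_pexp2l.
(* Split the exponent as q^j1 q^j2 with j2 <= a. The entries of the inner power are collapsed into
   equality tests, two layers higher, so that the outer power again expands products of width 1. *)
move=> ja; pose j2 := minn j a; pose j1 := j - j2.
have jE : j = j1 + j2 by rewrite subnK// geq_minl.
have j1a : j1 <= a * k.+1.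
  by move: ja; rewrite leq_subLR mulnS /j2 /minn; case: ltnP => // ? _; rewrite leq_addr.
have j2a : j2 <= a by rewrite geq_minr.
have HB : sumprod_mx k.+1.*2 (q * q) 1 (fun x => A x ^+ (q ^ j1)%N)%R.
  move=> i l; apply: sumprod_of_test => c.
  exact: (sumprod_test c bW sW (IH j1 j1a i l)).
move=> i l; have := sumprod_exp (q ^ j2) HB i l.
have -> : (fun x => ((A x ^+ (q ^ j1)%N) ^+ (q ^ j2)%N)%R i l)
        = (fun x => (A x ^+ (q ^ j)%N)%R i l).
  by apply/funext => x; rewrite -exprM -expnD -jE.
by apply: sumprod_le; rewrite leq_pexp2l// leq_pexp2l.
Qed.

End SumProd.

(** * Residue tests for block sums *)

Definition block_sum (n : nat) (P : pred nat) (x : n.-tuple bool) : nat :=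
  \sum_(0 <= i < n) (P i && nth false x i).

Section ModTests.
Variables (m W n q : nat) (q_pr : prime q) (q_m : q %| m) (m_gt0 : 0 < m).
Variable P : pred nat.

Let y (x : n.-tuple bool) l := P l && nth false x l.

(* Entry (i, j) of the D-th power counts the size-D sets of selected positions in [i, j) that
   contain j - 1, so row 0 sums to a binomial coefficient of the block sum. *)
Definition path_mx (x : n.-tuple bool) : 'M['F_q]_n.+1 :=
  (\matrix_(i, j) ((i < j)%N && y x j.-1)%:R)%R.

Lemma sumprod_path_mx : sumprod_mx m W 0 1 1 path_mx.
Proof.
move=> i j; case: (boolP ((i < j) && P j.-1)) => [/andP [lt_ij Pj]|no].
  have lt_j : j.-1 < n by rewrite -ltnS prednK ?ltn_ord// (leq_ltn_trans _ lt_ij).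
  exists [:: [:: [ffun x => tnth x (Ordinal lt_j)]]]; split => //.
    move=> hs; rewrite inE => /eqP ->; split => // h; rewrite inE => /eqP ->.
    by exists (Ordinal lt_j).
  move=> x; rewrite big_seq1 /= ffunE mxE lt_ij /y Pj /= andbT.
  by rewrite (tnth_nth false).
have [hss [sh Hh E]] := @sumprod_bool m W n q 0 1 1 false isT.
exists hss; split => // x; rewrite -E mxE /y andbA (negbTE no).
by [].
Qed.

(** Sets of D + 1 selected positions are sorted by their least element [l]; the other D lie after
    it. *)
Lemma sum_bin_suffix (z : nat -> bool) D i : i <= n ->
  \sum_(i <= l < n) z l * 'C(\sum_(l.+1 <= t < n) z t, D)
    = 'C(\sum_(i <= l < n) z l, D.+1).
Proof.
move=> /subnKC; move: (n - i) => k kE; elim: k i kE => [|k IH] i kE.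
  by rewrite addn0 in kE; rewrite kE !big_geq// bin0n.
have lt_i : i < n by rewrite -kE -addSnnS leq_addr.
rewrite !(big_ltn lt_i) IH; last by rewrite addSnnS.
by case: (z i); rewrite ?mul0n ?add0n// mul1n add1n binS addnC.
Qed.

Lemma row_path_mx x D (i : 'I_n.+1) :
  (\sum_j (path_mx x ^+ D) i j = 'C(\sum_(i <= l < n) y x l, D)%:R)%R.
Proof.
elim: D i => [|D IH] i.
  rewrite expr0 bin0 (bigD1 i)//= big1 => [|j ji]; first by rewrite mxE eqxx addr0.
  by rewrite mxE eq_sym (negbTE ji).
transitivity (\sum_l path_mx x i l * \sum_j (path_mx x ^+ D) l j)%R.
  under [RHS]eq_bigr do rewrite mulr_sumr.
  by rewrite exchange_big /=; apply: eq_bigr => j _; rewrite exprS mxE.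
under [LHS]eq_bigr do rewrite IH mxE.
rewrite big_ord_recl [X in (X * _)%R](_ : _ = 0%R) // mul0r add0r -sum_bin_suffix; last first.
  by rewrite -ltnS ltn_ord.
rewrite natr_sum.
transitivity (\sum_(0 <= l < n | (i <= l)%N)
   (y x l * 'C(\sum_(l.+1 <= t < n) y x t, D))%N%:R : 'F_q)%R.
  rewrite [RHS]big_mkcond /= [RHS]big_mkord; apply: eq_bigr => l _.
  by rewrite /bump /= add1n ltnS natrM; case: (i <= l); rewrite //= mul0r.
rewrite (@big_cat_nat _ _ _ i)//=; last by rewrite -ltnS ltn_ord.
rewrite big_nat_cond big_pred0 ?Monoid.mul1m => [|l]; last first.
  by rewrite /=; case: ltnP => // _; rewrite andbF.
by rewrite big_nat_cond [RHS]big_nat_cond; apply: eq_bigl => l; lia.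
Qed.

(** There is one test per digit. The powers of [path_mx] use all but two of the [l.*2] layers,
    summing row 0 costs only a factor [n.+1] in the number of terms, and the comparison with C(s,
    q^j) takes the last two layers. *)
Lemma mod_tests a l s : 0 < l -> q ^ a <= W ->
  m * (n.+1 * (n.+1 * (q * q)) ^ (q ^ a) + q) <= W ->
  exists Gs : seq (bfun n),
    [/\ size Gs <= a * l, {in Gs, forall G, layered m W l.*2 G} &
        forall x, all (fun G : bfun n => G x) Gs
                  = (block_sum P x == s %[mod q ^ (a * l)])].
Proof.
case: l => // l _ bW sW.
pose G j : bfun n :=
  [ffun x => ('C(block_sum P x, q ^ j)%:R == 'C(s, q ^ j)%:R :> 'F_q)%R].
exists (map G (iota 0 (a * l.+1))); split.
- by rewrite size_map size_iota.
- move=> _ /mapP [j jl ->]; rewrite mem_iota add0n /= in jl.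
  rewrite doubleS; set c := ('C(s, q ^ j)%:R)%R : 'F_q.
  have bE : (fun x => \sum_(i <- enum 'I_n.+1) (path_mx x ^+ (q ^ j)%N) ord0 i)%R
          = (fun x => ('C(block_sum P x, q ^ j))%:R : 'F_q)%R.
    by apply/funext => x; rewrite big_enum row_path_mx.
  have -> : G j = [ffun x => (\sum_(i <- enum 'I_n.+1)
                       (path_mx x ^+ (q ^ j)%N) ord0 i)%R == c].
    by apply/ffunP => x; rewrite !ffunE; have /= := congr1 (@^~ x) bE => ->.
  have sW' : m * ((n.+1 * (q * q)) ^ (q ^ a) + q) <= W.
    apply: leq_trans sW; rewrite leq_mul2l leq_add2r leq_pmull// orbT.
    by [].
  apply: (sumprod_test q_pr q_m m_gt0 c bW sW).
  rewrite -{1}[n.+1]card_ord cardE.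
  apply: (@sumprod_sum _ _ _ _ _ (enum 'I_n.+1) _ _ _
    (fun i x => (path_mx x ^+ (q ^ j)%N)%R ord0 i)) => i.
  by apply: (sumprod_exp_pow q_pr q_m m_gt0 sumprod_path_mx bW sW' (ltnW jl)).
- move=> x; rewrite all_map; apply/allP/eqP => [H|/(eq_mod_pow_binomials q_pr) H j].
    apply/(eq_mod_pow_binomials q_pr) => j jl.
    by have := H j; rewrite mem_iota add0n jl /= ffunE => /(_ isT) /eqP.
  by rewrite mem_iota add0n /= ffunE => jl; apply/eqP; apply: H.
Qed.

End ModTests.

(** * Amplification by random formulas *)

Section RealBounds.
Variable R : realType.
Local Open Scope ring_scope.
Implicit Types (a b e y z : R).

(** Multiply by exp(-z/2) >= 1 - z/2 and use (1 + z)(1 - z/2) >= 1 on [0, 1]. *)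
Lemma expR_half_le z : 0 <= z <= 1 -> expR (z / 2) <= 1 + z.
Proof.
move=> /andP [z0 z1].
have h : 1 - z / 2 <= expR (- (z / 2)) by exact: expR_ge1Dx.
have p : 0 < expR (z / 2) := expR_gt0 _.
have e : expR (z / 2) * expR (- (z / 2)) = 1 by rewrite -expRD subrr expR0.
nra.
Qed.

Lemma expR1_ge2 : 2 <= expR 1 :> R.
Proof. by have := expR_ge1Dx (1 : R); lra. Qed.

Lemma expR1_le4 : expR 1 <= 4 :> R.
Proof.
have h : 0 <= (1 : R) <= 1 by lra.
have := expR_half_le h; set t := expR _ => t2.
have t0 : 0 < t := expR_gt0 _.
have -> : 1 = 1 / 2 + 1 / 2 :> R by lra.
by rewrite expRD -/t; nra.
Qed.

Lemma one_sub_expRN_ge e : 0 <= e -> Num.min e 1 / 2 <= 1 - expR (- e).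
Proof.
move=> e0; have p : 0 < expR (- e) := expR_gt0 _.
have prod : expR e * expR (- e) = 1 by rewrite -expRD subrr expR0.
have h := expR_ge1Dx e.
case: (leP e 1) => e1; nra.
Qed.

(* For 0 <= b <= a <= 1 one has 1 - b >= (1 + (a - b)) (1 - a). *)
Lemma nor_ratio a b e (Y K : nat) :
  0 <= b -> 0 < a <= 1 -> 0 <= e -> b * expR e <= a ->
  (4 * Y)%:R <= K%:R * a ->
  (1 - a) ^+ K * expR (Y%:R * Num.min e 1) <= (1 - b) ^+ K.
Proof.
move=> b0 /andP [a0 a1] e0 ba KX.
have e1 : 1 <= expR e by have := expR_ge1Dx e; lra.
have b_le : b <= a * expR (- e).
  have prod : expR e * expR (- e) = 1 by rewrite -expRD subrr expR0.
  have p : 0 < expR (- e) := expR_gt0 _.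
  by rewrite -[b]mulr1 -prod mulrA ler_pM2r.
have h := one_sub_expRN_ge e0.
have ab : b <= a by nra.
(* Here a - b >= a (1 - exp(-e)) >= a min(e, 1) / 2, and K a >= 4 Y; this is where the 4 comes
   from. *)
have exp_le : Y%:R * Num.min e 1 <= K%:R * ((a - b) / 2).
  have m0 : 0 <= Num.min e 1 by rewrite le_min e0 ler01.
  have h2 : a * (Num.min e 1 / 2) <= a - b by nra.
  have h3 : (4 * Y)%:R * Num.min e 1 <= K%:R * a * Num.min e 1 by rewrite ler_wpM2r.
  have h4 : K%:R * (a * (Num.min e 1 / 2)) <= K%:R * (a - b) by rewrite ler_wpM2l.
  rewrite natrM in h3; lra.
apply: (@le_trans _ _ ((1 - a) ^+ K * expR (K%:R * ((a - b) / 2)))).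
  by rewrite ler_wpM2l ?exprn_ge0 ?ler_expR//; lra.
rewrite expRM_natl -exprMn lerXn2r ?nnegrE//.
- by rewrite mulr_ge0 ?expR_ge0//; lra.
- by lra.
have hz : 0 <= a - b <= 1 by lra.
have := expR_half_le hz; have : 0 <= 1 - a by lra.
nra.
Qed.

(** Keeps acceptance probabilities away from 0, which bounds the fan-in of the next NOR. If b <=
    1/2, then 1 - b >= exp(-2 b) and K b <= X + 1; otherwise K <= 2 (X + 1), and each factor is at
    least 1/V. *)
Lemma nor_lower a b (V X K : nat) :
  (4 <= V)%N -> 0 <= b -> 0 < a <= 1 -> b <= a -> V%:R^-1 <= 1 - b ->
  K%:R * a <= X.+1%:R -> (V%:R ^+ (2 * X.+1))^-1 <= (1 - b) ^+ K.
Proof.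
move=> V4 b0 /andP [a0 a1] ba bV KX.
have V4' : 4 <= V%:R :> R by rewrite (ler_nat _ 4).
have V0 : 0 < V%:R :> R by lra.
have VX : 0 < V%:R ^+ (2 * X.+1) :> R by rewrite exprn_gt0.
rewrite -[leLHS]mul1r ler_pdivrMr//.
case: (leP b (1 / 2)) => b2.
  have h : 1 <= (1 - b) * expR (2 * b).
    have := expR_ge1Dx (2 * b); nra.
  apply: (@le_trans _ _ (((1 - b) * expR (2 * b)) ^+ K)); first exact: exprn_ege1.
  rewrite exprMn ler_wpM2l ?exprn_ge0//; first lra.
  rewrite -expRM_natl.
  apply: (@le_trans _ _ (expR 1 ^+ (2 * X.+1))).
    rewrite -expRM_natl mulr1 ler_expR natrM.
    have : K%:R * b <= K%:R * a by rewrite ler_wpM2l.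
    lra.
  by rewrite lerXn2r ?nnegrE ?expR_ge0//; have := expR1_le4; lra.
have KX2 : (K <= 2 * X.+1)%N.
  rewrite -(ler_nat R) natrM; have : K%:R * (1 / 2) <= K%:R * a.
    by rewrite ler_wpM2l//; lra.
  lra.
apply: (@le_trans _ _ ((V%:R * (1 - b)) ^+ K)).
  by apply: exprn_ege1; rewrite mulrC -ler_pdivrMr// mul1r.
rewrite exprMn mulrC ler_wpM2l ?exprn_ge0//; first
  by have : 0 < V%:R^-1 :> R; [rewrite invr_gt0|lra].
by rewrite ler_weXn2l//; lra.
Qed.

Lemma one_sub_exp_le a (K : nat) : 0 <= a <= 1 -> (1 - a) ^+ K <= expR (- (K%:R * a)).
Proof.
move=> /andP [a0 a1]; rewrite -mulrN expRM_natl lerXn2r ?nnegrE ?expR_ge0//; first lra.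
exact: expR_ge1Dx.
Qed.

(** After k rounds the value is at least min(1, Y^k e). The cap at 1 does no harm in the last round,
    which still yields min(Y, Y^D e) >= L. *)
Lemma iter_amplify (Y L e : R) (D : nat) :
  1 <= Y -> L <= Y -> 0 <= e -> L <= Y ^+ D * e -> (0 < D)%N ->
  L <= iter D (fun t => Y * Num.min t 1) e.
Proof.
move=> Y1 LY e0 LD; case: D LD => // D LD _.
have key k : Num.min 1 (Y ^+ k * e) <= iter k (fun t => Y * Num.min t 1) e.
  elim: k => [|k IH]; first by rewrite expr0 mul1r ge_min lexx orbT.
  rewrite iterS; set t := iter _ _ _ in IH *.
  have t0 : 0 <= Num.min 1 (Y ^+ k * e).
    by rewrite le_min ler01 mulr_ge0 ?exprn_ge0//; lra.
  rewrite exprS -mulrA; set w := Y ^+ k * e in IH t0 *.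
  have Y0 : 0 <= Y by lra.
  have m1 : Num.min w 1 <= Num.min t 1.
    by rewrite le_min [Num.min w 1]minC IH ge_min lexx.
  apply: le_trans (ler_wpM2l Y0 m1).
  by case: (leP w 1) => hw; case: (leP 1 _) => h2 //; nra.
rewrite iterS; have := key D; set t := iter _ _ _ => kt.
rewrite exprS -mulrA in LD; set w := Y ^+ D * e in LD kt.
apply: (@le_trans _ _ (Y * Num.min 1 w)).
  by case: (leP 1 w) => hw //; lra.
have Y0 : 0 <= Y by lra.
by apply: ler_wpM2l => //; rewrite le_min kt ge_min lexx.
Qed.

End RealBounds.

(** * Random NORs and their derandomization *)

Section Sampler.
Variables (R : realType) (m W n V Y : nat).
Hypothesis V4 : 4 <= V.
Hypothesis Y_gt0 : 0 < Y.
Let X := 4 * Y.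
Hypothesis W_ge : (X + n.+3) * V ^ (2 * X.+1) <= W.

Definition accept_prob (O : finType) (h : O -> bfun n) (x : n.-tuple bool) : R :=
  (#|[set w | h w x]|%:R / #|O|%:R)%R.

(* The parameter [e] bounds the log-ratio of the acceptance probabilities on [big] and [small].
   With [neg], it is the negation of each [h w] that has a depth-k formula: passing to a NOR
   swaps the roles of [big] and [small] and toggles [neg], so no NOT gate is ever spent. *)
Definition sampler (k : nat) (neg : bool) (big small : pred (n.-tuple bool)) (e : R) :=
  exists (O : finType) (h : O -> bfun n) (a b : R),
    [/\ 0 < #|O|,
        forall w, layered m W k [ffun x => neg (+) h w x],
        [/\ 0 <= b, 0 < a <= 1, 0 <= e & b * expR e <= a]%R,
        (V%:R^-1 <= 1 - b)%R /\ ((V%:R ^+ (2 * X.+1))^-1 <= a)%R &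
        forall x, (big x -> a <= accept_prob h x)%R /\
                  (small x -> accept_prob h x <= b)%R].

Lemma accept_prob_le1 (O : finType) (h : O -> bfun n) x : (accept_prob h x <= 1)%R.
Proof.
rewrite /accept_prob; have [->|Opos] := posnP #|O|; first by rewrite invr0 mulr0 ler01.
by rewrite ler_pdivrMr ?ltr0n// mul1r ler_nat max_card.
Qed.

Lemma accept_prob_ge0 (O : finType) (h : O -> bfun n) x : (0 <= accept_prob h x)%R.
Proof. by rewrite divr_ge0 ?ler0n. Qed.

Definition nor_fun (O : finType) (h : O -> bfun n) (K : nat) (w : {ffun 'I_K -> O}) : bfun n :=
  [ffun x => [forall i, ~~ h (w i) x]].

Lemma accept_prob_nor (O : finType) (h : O -> bfun n) (K : nat) x : 0 < #|O| ->
  accept_prob (@nor_fun O h K) x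
  = ((1 - accept_prob h x) ^+ K)%R.
Proof.
move=> Opos; rewrite /accept_prob card_ffun card_ord natrX.
have -> : #|[set w | @nor_fun O h K w x]|
        = #|~: [set w | h w x]| ^ K.
  rewrite -[K in RHS]card_ord -card_ffun_on; apply: eq_card => w.
  rewrite inE ffunE; apply/forallP/ffun_onP => H i; have := H i; first by rewrite !inE.
  by rewrite !inE.
rewrite natrX -expr_div_n; congr (_ ^+ _)%R.
have Opos' : (#|O|%:R != 0 :> R)%R by rewrite pnatr_eq0 -lt0n.
have := cardsC [set w | h w x] => /(congr1 (fun k => k%:R : R)%R).
rewrite natrD => O_eq; move: Opos'; rewrite -O_eq => Opos'.
by field.
Qed.

(** The expected number K a of accepting samples can be set to within 1 of [Z]; the lower bound on
    [a] keeps the fan-in K below [W]. *)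
Lemma nor_width (Z : nat) (a : R) : (0 < a <= 1)%R ->
  ((V%:R ^+ (2 * X.+1))^-1 <= a)%R -> Z <= X + n.+2 ->
  exists K : nat, [/\ (K <= W)%N, (Z%:R <= K%:R * a)%R & (K%:R * a <= Z.+1%:R)%R].
Proof.
move=> /andP [a0 a1] aV ZX; exists (Num.truncn (Z%:R / a)%R).+1.
have Za : (0 <= Z%:R / a)%R by rewrite divr_ge0 ?ler0n// ltW.
have /andP [t1 t2] := truncn_itv Za.
have V0 : (0 < V%:R ^+ (2 * X.+1) :> R)%R.
  by rewrite exprn_gt0// ltr0n (leq_trans _ V4).
have le_K : ((Num.truncn (Z%:R / a)).+1%:R * a <= Z.+1%:R :> R)%R.
  rewrite -natr1 mulrDl mul1r -[leRHS]natr1 lerD//.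
  by rewrite -ler_pdivlMr.
split=> //; last by rewrite -ler_pdivrMr// ltW.
apply: leq_trans W_ge; rewrite -(ler_nat R) natrM natrX.
rewrite -(@ler_pM2r _ a)//; apply: (le_trans le_K).
apply: (@le_trans _ _ ((X + n.+3)%N%:R)%R); first by rewrite ler_nat addnS.
rewrite -[leLHS]mulr1 -mulrA ler_wpM2l ?ler0n//.
by rewrite -ler_pdivrMl// mulr1.
Qed.

Lemma sampler_nor k neg big small e :
  sampler k neg big small e ->
  sampler k.+1 (~~ neg) small big (Y%:R * Num.min e 1)%R.
Proof.
case=> O [h [a [b [Opos Hh [b0 ab e0 ba] [bV aV] Hp]]]].
have [K [KW K1 K2]] := nor_width ab aV (leq_addr _ _).
have le_ba : (b <= a)%R.
  have h1 := expR_ge1Dx e; have : (0 <= b * (expR e - 1))%R by rewrite mulr_ge0//; lra.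
  lra.
have a1 : (a <= 1)%R by case/andP: ab.
have a0 : (0 < a)%R by case/andP: ab.
have V4' : (4 <= V%:R :> R)%R by rewrite (ler_nat _ 4).
have b1 : (b < 1)%R.
  have : (0 < V%:R^-1 :> R)%R by rewrite invr_gt0; lra.
  lra.
exists {ffun 'I_K -> O}, (@nor_fun O h K).
exists ((1 - b) ^+ K)%R, ((1 - a) ^+ K)%R; split.
- by rewrite card_ffun expn_gt0 Opos.
- move=> w; pose Gs := [seq [ffun x => neg (+) h (w i) x] : bfun n | i <- enum 'I_K].
  have sG : size Gs <= W by rewrite size_map size_enum_ord.
  have HG : {in Gs, forall G, layered m W k G} by move=> _ /mapP [i _ ->].
  case: neg Hh @Gs sG HG => Hh Gs sG HG /=.
    have -> : [ffun x => nor_fun h w x]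
            = [ffun x => all (fun G : bfun n => G x) Gs].
      apply/ffunP => x; rewrite !ffunE all_map; apply/forallP/allP => H i.
        by move=> _; rewrite /= ffunE.
      by have := H i (mem_enum _ _); rewrite /= ffunE.
    exact: layered_and.
  have -> : [ffun x => ~~ nor_fun h w x]
          = [ffun x => has (fun G : bfun n => G x) Gs].
    apply/ffunP => x; rewrite !ffunE has_map negb_forall.
    apply/existsP/hasP => [[i]|[i _]].
      by rewrite negbK => hi; exists i; rewrite ?mem_enum//= ffunE.
    by rewrite /= ffunE => hi; exists i; rewrite negbK.
  exact: layered_or.
- split.
  + by rewrite exprn_ge0//; lra.
  + rewrite exprn_gt0 ?exprn_ile1//; lra.
  + by rewrite mulr_ge0 ?ler0n// le_min e0 ler01.
  + by apply: nor_ratio.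
- split; last exact: (nor_lower V4 b0 ab le_ba bV K2).
  (* The new upper probability (1 - a)^K is at most exp(-1) <= 1/2, so its complement is at least
     1/4 >= 1/V. *)
  have h1 := one_sub_exp_le K (_ : 0 <= a <= 1)%R.
  have {}h1 := h1 (introT andP (conj (ltW a0) a1)).
  have h2 : (expR (- (K%:R * a)) <= expR (- 1) :> R)%R.
    rewrite ler_expR lerN2 (le_trans _ K1)// (ler_nat _ 1) muln_gt0 //.
  have h3 : (expR (-1) * expR 1 = 1 :> R)%R by rewrite -expRD addNr expR0.
  have h4 := expR1_ge2 R; have h5 : (0 < expR (-1) :> R)%R := expR_gt0 _.
  have h6 : (V%:R^-1 <= 4^-1 :> R)%R by rewrite lef_pV2 ?posrE//; lra.
  have h7 : (expR (-1) <= 2^-1 :> R)%R by nra.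
  lra.
- move=> x; rewrite accept_prob_nor//; have p1 := accept_prob_le1 h x.
  have [Hb Hs] := Hp x; split=> [/Hs|/Hb] p2; rewrite lerXn2r ?nnegrE//; lra.
Qed.

Lemma sampler_iter k neg big small e D :
  sampler k neg big small e ->
  sampler (k + D) (neg (+) odd D) (if odd D then small else big)
    (if odd D then big else small) (iter D (fun t => Y%:R * Num.min t 1)%R e).
Proof.
move=> S0; elim: D => [|D IH]; first by rewrite addn0 addbF.
have := sampler_nor IH; rewrite addnS iterS oddS addbN.
by case: (odd D).
Qed.

(** Take ORs of K samples with K a >= n + 2. On [big] such an OR fails with probability at most
    exp(-(n + 2)), small enough for a union bound; on [small] the ratio exp(e) makes K b <= 1/4, so
    it rejects with probability at least 3/4. *)
Lemma sampler_or_and k big small e :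
  (16 * n.+2%:R <= expR e)%R ->
  sampler k false big small e ->
  exists Es : seq (seq (bfun n)),
    [/\ size Es <= n.+1,
        {in Es, forall gs, size gs <= W /\ {in gs, forall g, layered m W k g}},
        forall x, big x -> all (has (fun g : bfun n => g x)) Es &
        forall x, small x -> has (fun gs => ~~ has (fun g : bfun n => g x) gs) Es].
Proof.
move=> e_ge; case=> O [h [a [b [Opos Hh [b0 ab e0 ba] [bV aV] Hp]]]].
have [K [KW K1 K2]] := nor_width ab aV (leq_addl _ _).
have /andP [a0 a1] := ab.
pose Om := {ffun 'I_K -> O}.
pose rej (w : Om) (x : n.-tuple bool) := [forall i, ~~ h (w i) x].
pose rset x := [set w : Om | rej w x].
have Om0 : 0 < #|{: Om}| by rewrite card_ffun expn_gt0 Opos.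
have prE x : (#|rset x|%:R = (1 - accept_prob h x) ^+ K * #|{: Om}|%:R :> R)%R.
  rewrite -accept_prob_nor// /accept_prob divfK ?pnatr_eq0 -?lt0n//.
  by congr (_%:R)%R; apply: eq_card => w; rewrite !inE ffunE.
have big_le x : big x -> #|rset x| * 2 ^ n.+2 <= #|{: Om}|.
  move=> bx; rewrite -(ler_nat R) natrM prE natrX.
  have [/(_ bx) pa _] := Hp x; have p1 := accept_prob_le1 h x.
  have p0 : (0 <= accept_prob h x <= 1)%R by lra.
  have h1 := one_sub_exp_le K p0.
  have h2 : (expR (- (K%:R * accept_prob h x)) <= expR (- n.+2%:R) :> R)%R.
    rewrite ler_expR lerN2 (le_trans K1)// ler_wpM2l//.
  have h3 : (expR (- n.+2%:R) * 2 ^+ n.+2 <= 1 :> R)%R.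
    rewrite expRN mulrC ler_pdivrMr ?expR_gt0// mul1r -[(n.+2%:R)%R]mulr1 expRM_natl.
    rewrite lerXn2r ?nnegrE ?expR_ge0//; exact: expR1_ge2.
  rewrite -mulrA [(#|_|%:R * _)%R]mulrC mulrA -[leRHS]mul1r ler_wpM2r//.
  apply: le_trans h3; rewrite ler_wpM2r ?exprn_ge0//.
  exact: le_trans h1 h2.
have small_ge x : small x -> 3 * #|{: Om}| <= 4 * #|rset x|.
  move=> sx; rewrite -(ler_nat R) !natrM prE.
  have [_ /(_ sx) pb] := Hp x; have p0 := accept_prob_ge0 h x.
  have h1 : (1 - K%:R * b <= (1 - accept_prob h x) ^+ K)%R.
    have le1 : (b <= 1)%R.
      by have : (0 < V%:R^-1 :> R)%R; [rewrite invr_gt0 ltr0n (leq_trans _ V4)|lra].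
    apply: (@le_trans _ _ ((1 - b) ^+ K)%R); last by rewrite lerXn2r ?nnegrE//; lra.
    elim: (K) => [|j IHj]; first by rewrite mul0r subr0 expr0.
    rewrite exprS -natr1; have : (0 <= j%:R * b * b)%R by rewrite !mulr_ge0.
    have : ((1 - b) * (1 - j%:R * b) <= (1 - b) * (1 - b) ^+ j)%R by rewrite ler_wpM2l//; lra.
    lra.
  have h2 : (K%:R * b <= 4^-1)%R.
    have n2 : (2 <= n.+2%:R :> R)%R by rewrite (ler_nat _ 2).
    have h3 : (b * (16 * n.+2%:R) <= a)%R by apply: le_trans ba; rewrite ler_wpM2l.
    have h4 : (K%:R * (b * (16 * n.+2%:R)) <= K%:R * a)%R by rewrite ler_wpM2l.
    have h5 : (n.+3%:R = n.+2%:R + 1 :> R)%R by rewrite natr1.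
    rewrite h5 in K2; have Kb : (0 <= K%:R * b)%R by rewrite mulr_ge0.
    have h6 : (K%:R * b * n.+2%:R * 16 <= n.+2%:R * 2)%R by lra.
    have h7 : (K%:R * b * 16 <= 2)%R by rewrite -(@ler_pM2r _ (n.+2%:R)%R) ?ltr0n//; lra.
    lra.
  have h3 : (0 <= #|{: Om}|%:R :> R)%R by [].
  nra.
(* Discard the few samples that reject some input in [big]; the others still reject each input
   in [small] at least half of the time, so n + 1 of them suffice. *)
pose bad := \bigcup_(x | big x) rset x.
have bad_le : 4 * #|bad| <= #|{: Om}|.
  have h1 : #|bad| * 2 ^ n.+2 <= 2 ^ n * #|{: Om}|.
    apply: (@leq_trans (\sum_(x | big x) #|rset x| * 2 ^ n.+2)).
      rewrite -big_distrl /= leq_mul2r; apply/orP; right.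
      rewrite /bad; elim/big_ind2 : _ => //; first by rewrite cards0.
      by move=> A1 s1 A2 s2 l1 l2; rewrite (leq_trans (leq_card_setU _ _).1)// leq_add.
    apply: (@leq_trans (\sum_(x | big x) #|{: Om}|)); first exact: leq_sum.
    rewrite sum_nat_const leq_mul2r; apply/orP; right.
    by rewrite (leq_trans (max_card _))// card_tuple card_bool.
  rewrite -(@leq_pmul2l (2 ^ n)) ?expn_gt0//; apply: leq_trans h1.
  by rewrite !expnS; move: #|bad| (2 ^ n) => c1 c2; clear; lia.
have badC : #|bad| + #|~: bad| = #|{: Om}| := cardsC bad.
have [|||L [sL LP HL]] := @hitting_list _ _ (~: bad) rej n.+1 [set x | small x].
- rewrite lt0n; apply/eqP => c0; move: badC bad_le Om0; rewrite c0 addn0 => <-.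
  by case: #|bad| => // c; clear; lia.
- by rewrite (leq_ltn_trans (max_card _))// card_tuple card_bool ltn_exp2l.
- move=> x; rewrite inE => /small_ge sx.
  have -> : [set w in ~: bad | rej w x] = rset x :\: bad.
    by apply/setP => w; rewrite !inE.
  have h1 := cardsID bad (rset x).
  have h2 : #|rset x :&: bad| <= #|bad| by rewrite subset_leq_card// subsetIr.
  move: sx h1 h2 bad_le badC; move: #|rset x :\: bad| #|rset x :&: bad| #|rset x|.
  by move: #|bad| #|~: bad| #|{: Om}| => c1 c2 c3 c4 c5 c6; clear; lia.
pose gs (w : Om) := [seq [ffun x => h (w i) x] : bfun n | i <- enum 'I_K].
have has_gs w x : has (fun g : bfun n => g x) (gs w) = ~~ rej w x.
  rewrite has_map negb_forall; apply/hasP/existsP => [[i _]|[i]].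
    by rewrite /= ffunE => hi; exists i; rewrite negbK.
  by rewrite negbK => hi; exists i; rewrite ?mem_enum//= ffunE.
exists (map gs L); split.
- by rewrite size_map.
- move=> _ /mapP [w _ ->]; split; first by rewrite size_map size_enum_ord.
  by move=> _ /mapP [i _ ->]; have := Hh (w i).
- move=> x bx; rewrite all_map; apply/allP => w /LP; rewrite inE => nb /=.
  rewrite has_gs; apply: contra nb => r; apply/bigcupP; exists x => //.
  by rewrite inE.
- move=> x sx; have /hasP [w wL r] : has (rej^~ x) L by apply: HL; rewrite inE.
  by rewrite has_map; apply/hasP; exists w => //=; rewrite has_gs negbK.
Qed.

End Sampler.

(** * Gap tests for the number of ones in a block *)

Section BlockTest.
Variables (R : realType) (m W n V Y : nat).
Hypothesis V4 : 4 <= V.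
Hypothesis Y_gt0 : 0 < Y.
Let X := 4 * Y.
Hypothesis W_ge : (X + n.+3) * V ^ (2 * X.+1) <= W.
Variable P : pred nat.
Let A := [set i : 'I_n | P i].
Hypothesis AV : #|A| <= V.

Lemma block_sumE (x : n.-tuple bool) : block_sum P x = \sum_(w < #|A|) tnth x (enum_val w).
Proof.
transitivity (\sum_(i in A) (tnth x i : nat)); last by rewrite big_enum_val.
rewrite /block_sum big_mkord [RHS]big_mkcond /=; apply: eq_bigr => i _; rewrite inE.
by rewrite (tnth_nth false); case: (P i).
Qed.

Lemma block_sum_le (x : n.-tuple bool) : block_sum P x <= #|A|.
Proof.
rewrite block_sumE -[leqRHS]card_ord -[leqRHS]sum1_card; apply: leq_sum => i _.
exact: leq_b1.
Qed.

Definition pick_input (neg : bool) (w : 'I_#|A|) : bfun n :=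
  [ffun x => neg (+) tnth x (enum_val w)].

Lemma accept_pick_input neg x : accept_prob R (pick_input neg) x =
  ((if neg then #|A| - block_sum P x else block_sum P x)%N%:R / #|A|%:R)%R.
Proof.
rewrite /accept_prob card_ord block_sumE; congr (_%:R / _)%R.
have E : #|[set w | pick_input false w x]| = \sum_(w < #|A|) tnth x (enum_val w).
  rewrite -sum1_card big_mkcond /=; apply: eq_bigr => w _.
  by rewrite inE ffunE /=; case: (tnth _ _).
case: neg; last exact: E.
have -> : [set w | pick_input true w x] = ~: [set w | pick_input false w x].
  by apply/setP => w; rewrite !inE !ffunE.
have := cardsC [set w | pick_input false w x].
by rewrite card_ord -E ; move: #|[set w | _]| #|~: _| => c d <-; rewrite addKn.
Qed.

(* Starting from the negated input for odd depth makes the final polarity positive. *)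
Lemma sampler_pick_input neg u g : 0 < g -> g <= u -> u <= #|A| ->
  let big (x : n.-tuple bool) := (u <= block_sum P x) in
  let small (x : n.-tuple bool) := (block_sum P x + g <= u) in
  sampler m W V Y 0 neg (if neg then small else big) (if neg then big else small)
    (g%:R / #|A|%:R / 2 : R)%R.
Proof.
move=> g0 gu uA big small.
have A0 : 0 < #|A| by lia.
(* With [neg] the zeros of the block are counted: there are at least |A| - u + g of them when the
   sum is at most u - g, and at most |A| - u when it is at least u. *)
have [u' [gu' u'A u'E]] : exists u', [/\ g <= u', u' <= #|A| &
    u' = if neg then #|A| - u + g else u].
  exists (if neg then #|A| - u + g else u).
  by move: gu uA; clear; case: neg => gu uA; split=> //; lia.
have AR : (0 < #|A|%:R :> R)%R by rewrite ltr0n.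
have AVR : (#|A|%:R <= V%:R :> R)%R by rewrite ler_nat.
have V4' : (4 <= V%:R :> R)%R by rewrite (ler_nat _ 4).
have gR : (1 <= g%:R :> R)%R by rewrite (ler_nat _ 1).
have guR : (g%:R <= u'%:R :> R)%R by rewrite ler_nat.
have uAR : (u'%:R <= #|A|%:R :> R)%R by rewrite ler_nat.
exists 'I_#|A|, (pick_input neg), (u'%:R / #|A|%:R)%R, ((u' - g)%N%:R / #|A|%:R)%R.
have VA : (V%:R^-1 <= #|A|%:R^-1 :> R)%R by rewrite lef_pV2 ?posrE//; lra.
have gA : (#|A|%:R^-1 <= g%:R / #|A|%:R :> R)%R.
  by rewrite -[leLHS]mul1r ler_wpM2r ?invr_ge0//; lra.
split.
- by rewrite card_ord.
- move=> w; exists (enum_val w); apply/ffunP => x.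
  by rewrite !ffunE addbA addbb.
- have ug : ((u' - g)%N%:R / #|A|%:R = u'%:R / #|A|%:R - g%:R / #|A|%:R :> R)%R.
    by rewrite natrB// mulrBl.
  have z1 : (u'%:R / #|A|%:R <= 1 :> R)%R by rewrite ler_pdivrMr// mul1r.
  have z2 : (g%:R / #|A|%:R <= u'%:R / #|A|%:R :> R)%R.
    by rewrite ler_wpM2r ?invr_ge0//; lra.
  have z3 : (0 < #|A|%:R^-1 :> R)%R by rewrite invr_gt0.
  split; rewrite ?ug; [lra|lra|lra|].
  (* With a = u'/|A| and z = g/|A|, (a - z) exp(z/2) <= (a - z)(1 + z) <= a because a <= 1. *)
  have z0 : (0 <= (g%:R / #|A|%:R : R) <= 1)%R by lra.
  have := @expR_half_le R _ z0; move: (_ / _)%R z1 z2 => a z1; move: (g%:R / _)%R z0 => z z0 z2.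
  move=> h; have : ((a - z) * expR (z / 2) <= (a - z) * (1 + z))%R by rewrite ler_wpM2l//; lra.
  nra.
- split.
    have -> : (1 - (u' - g)%N%:R / #|A|%:R = (#|A| - u' + g)%N%:R / #|A|%:R :> R)%R.
      rewrite natrD !natrB//; move: AR; move: (#|A|%:R : R)%R (u'%:R : R)%R (g%:R : R)%R.
      by move=> c1 c2 c3 c0; field; rewrite gt_eqF.
    apply: (le_trans VA); rewrite -[leLHS]mul1r ler_wpM2r ?invr_ge0//.
    by rewrite (ler_nat _ 1) addn_gt0 g0 orbT.
  apply: (@le_trans _ _ (V%:R^-1)%R).
    rewrite lef_pV2 ?posrE ?exprn_gt0//; [|lra|lra].
    by rewrite -[leLHS]expr1 ler_weXn2l//; lra.
  apply: (le_trans VA); rewrite -[leLHS]mul1r ler_wpM2r ?invr_ge0//; lra.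
- move=> x; rewrite accept_pick_input; have := block_sum_le x.
  have leA (c d : nat) : c <= d -> (c%:R / #|A|%:R <= d%:R / #|A|%:R :> R)%R.
    by move=> cd; rewrite ler_wpM2r ?invr_ge0// ?ler_nat//; lra.
  rewrite u'E /big /small; case: neg {u'E} => sA; split => h; apply: leA; lia.
Qed.

Lemma block_gap_test (L : R) (D u g : nat) :
  0 < D -> 0 < g -> (16 * n.+2%:R <= expR L)%R -> (L <= Y%:R)%R ->
  (L * #|A|%:R * 2 <= Y%:R ^+ D * g%:R)%R ->
  exists Es : seq (seq (bfun n)),
    [/\ size Es <= n.+1,
        {in Es, forall gs, size gs <= W /\ {in gs, forall g, layered m W D g}},
        forall x : n.-tuple bool, u <= block_sum P x -> all (has (fun g : bfun n => g x)) Es &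
        forall x : n.-tuple bool, block_sum P x + g <= u ->
          has (fun gs => ~~ has (fun g : bfun n => g x) gs) Es].
Proof.
move=> D0 g0 Ln LY LD.
(* For u < g nothing has to be rejected, and the empty conjunction serves. *)
case: (leqP g u) => [gu|ug]; last first.
  by exists [::]; split => // x; lia.
(* For u > |A| nothing has to be accepted, and one empty clause rejects every input. *)
case: (leqP u #|A|) => [uA|Au]; last first.
  exists [:: [::]]; split => //.
    by move=> gs; rewrite inE => /eqP ->.
  by move=> x; have := block_sum_le x; lia.
have S := sampler_iter V4 Y_gt0 W_ge D (sampler_pick_input (odd D) g0 gu uA).
have AR : (0 < #|A|%:R :> R)%R by rewrite ltr0n; lia.
set e0 := (g%:R / #|A|%:R / 2)%R in S.
have e00 : (0 <= e0)%R by rewrite /e0 !divr_ge0.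
have eL : (L <= iter D (fun t => Y%:R * Num.min t 1) e0)%R.
  apply: iter_amplify => //; first by rewrite (ler_nat _ 1).
  by rewrite /e0 !mulrA ler_pdivlMr// ler_pdivlMr//; lra.
rewrite addbb add0n in S.
have Ln' : (16 * n.+2%:R <= expR (iter D (fun t => Y%:R * Num.min t 1) e0))%R.
  by apply: le_trans Ln _; rewrite ler_expR.
have S' : sampler m W V Y D false (fun x : n.-tuple bool => u <= block_sum P x)
    (fun x => block_sum P x + g <= u) (iter D (fun t => Y%:R * Num.min t 1)%R e0).
  by move: S; case: (odd D).
exact: (sampler_or_and V4 W_ge Ln' S').
Qed.

End BlockTest.

(** * Exact sums *)

Lemma eqn_mod_prod (qs : seq nat) (e : nat -> nat) (x y : nat) :
  uniq qs -> {in qs, forall p, prime p} ->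
  (x == y %[mod \prod_(p <- qs) p ^ e p]) = all (fun p => x == y %[mod p ^ e p]) qs.
Proof.
wlog le_yx : x y / y <= x => [H|].
  case: (leqP y x) => [|/ltnW] le u pr; first exact: H.
  by rewrite eq_sym H//; apply: eq_all => p; rewrite eq_sym.
rewrite eqn_mod_dvd//; elim: qs => [|p qs IH] /=; first by rewrite big_nil dvd1n.
move=> /andP [pqs u] pr; rewrite big_cons Gauss_dvd ?IH ?eqn_mod_dvd//.
- by move=> q qqs; apply: pr; rewrite inE qqs orbT.
- rewrite coprimeXl// big_seq.
  elim/big_ind : _ => [|z1 z2 h1 h2|q qqs]; first exact: coprimen1.
    by rewrite coprimeMr h1.
  rewrite coprimeXr// prime_coprime ?pr ?mem_head//.
  rewrite dvdn_prime2 ?pr ?mem_head ?inE ?qqs ?orbT//.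
  by apply: contraNneq pqs => ->.
Qed.

Lemma dnf_le m W n k N N' w w' (F : bfun n) :
  N <= N' -> w <= w' -> dnf m W k N w F -> dnf m W k N' w' F.
Proof.
move=> NN ww [Ts [sT HT E]]; exists Ts; split => //; first exact: leq_trans sT NN.
by move=> t /HT [st Ht]; split => //; apply: leq_trans st ww.
Qed.

Lemma eq_of_mod (x y g : nat) : x < y + g -> y < x + g -> x = y %[mod g] -> x = y.
Proof.
have H x' y' : y' <= x' -> x' < y' + g -> x' = y' %[mod g] -> x' = y'.
  move=> le_yx lt_xy /eqP; rewrite eqn_mod_dvd// => /dvdnP [c cE].
  case: c cE => [|c] cE; first by rewrite -(subnK le_yx) cE.
  by move: lt_xy; rewrite -(subnK le_yx) cE mulSn; lia.
move=> xy yx e; case: (leqP y x) => le; first exact: H.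
by apply/esym; apply: H => //; exact: ltnW.
Qed.

Section SymmetricDnf.
Variables (R : realType) (m W n V Y l : nat) (L : R).
Hypothesis m1 : 1 < m.
Hypothesis V4 : 4 <= V.
Hypothesis Y_gt0 : 0 < Y.
Let X := 4 * Y.
Hypothesis W_ge : (X + n.+3) * V ^ (2 * X.+1) <= W.
(** The parameter [l] is shifted by one, so this is the number 3 (l + 1) - 2 of NOR layers. *)
Let D := (3 * l).+1.
Variables (qs : seq nat) (a : nat -> nat).
Hypothesis qs_uniq : uniq qs.
Hypothesis qs_prime : {in qs, forall p, prime p}.
Hypothesis qs_m : {in qs, forall p, p %| m}.
Hypothesis qs_width : {in qs, forall p, p ^ a p <= W}.
Hypothesis qs_size : {in qs, forall p,
  m * (n.+1 * (n.+1 * (p * p)) ^ (p ^ a p) + p) <= W}.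
Let g := \prod_(p <- qs) p ^ (a p * l.+1).
Hypothesis L_ge : (16 * n.+2%:R <= expR L)%R.
Hypothesis LY : (L <= Y%:R)%R.
Let w := \sum_(p <- qs) a p * l.+1 + (n.+1 + n.+1).

Let W_gt0 : 0 < W.
Proof. by apply: leq_trans W_ge; rewrite muln_gt0 addn_gt0 orbT expn_gt0 (leq_trans _ V4). Qed.

Let g_gt0 : 0 < g.
Proof.
rewrite /g big_seq; elim/big_ind: _ => // [x y x0 y0|p pq]; first by rewrite muln_gt0 x0.
by rewrite expn_gt0 prime_gt0 ?qs_prime.
Qed.

(** By the Chinese remainder theorem the tests for the separate prime powers combine. Their 2 (l +
    1) layers fit into D + 1 = 3 l + 2. *)
Lemma all_mod_tests (P : pred nat) (s : nat) : exists Gs : seq (bfun n),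
  [/\ size Gs <= \sum_(p <- qs) a p * l.+1,
      {in Gs, forall G, layered m W D.+1 G} &
      forall x : n.-tuple bool,
        all (fun G : bfun n => G x) Gs = (block_sum P x == s %[mod g])].
Proof.
have H x : (block_sum P x == s %[mod g]) =
    all (fun p => block_sum P x == s %[mod p ^ (a p * l.+1)]) qs.
  by rewrite /g eqn_mod_prod.
suff [Gs [sG HG E]] : exists Gs : seq (bfun n),
  [/\ size Gs <= \sum_(p <- qs) a p * l.+1,
      {in Gs, forall G, layered m W D.+1 G} &
      forall x : n.-tuple bool, all (fun G : bfun n => G x) Gs =
        all (fun p => block_sum P x == s %[mod p ^ (a p * l.+1)]) qs].
  by exists Gs; split => // x; rewrite E H.
have m0 : 0 < m by apply: ltnW.
elim: (qs) qs_prime qs_m qs_width qs_size => [|p ps IH] pr pm pW pS.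
  by exists [::].
have [||||Gs [sG HG E]] := IH.
- by move=> q qq; apply: pr; rewrite inE qq orbT.
- by move=> q qq; apply: pm; rewrite inE qq orbT.
- by move=> q qq; apply: pW; rewrite inE qq orbT.
- by move=> q qq; apply: pS; rewrite inE qq orbT.
have pin := mem_head p ps.
have [Gs' [sG' HG' E']] := mod_tests (n := n) (pr p pin) (pm p pin) m0 P s (ltn0Sn l)
  (pW p pin) (pS p pin).
exists (Gs' ++ Gs); split.
- by rewrite size_cat big_cons leq_add.
- move=> G; rewrite mem_cat => /orP [/HG'|/HG] //.
  by apply: layered_le; [exact: W_gt0|rewrite /D; lia].
- by move=> x; rewrite all_cat E E'.
Qed.

(* The block sum is known modulo g and confined to the open interval (s - g, s + g). *)
Lemma block_exact (P : pred nat) (s : nat) :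
  (#|[set i : 'I_n | P i]| <= V)%N ->
  (L * #|[set i : 'I_n | P i]|%:R * 2 <= Y%:R ^+ D * g%:R)%R ->
  dnf m W D.+1 n.+1 w [ffun x : n.-tuple bool => block_sum P x == s].
Proof.
move=> AV LD.
have [G1 [s1 h1 E1]] := all_mod_tests P s.
have [El [sl hl El1 El2]] :=
  block_gap_test m V4 Y_gt0 W_ge AV s (ltn0Sn _) g_gt0 L_ge LY LD.
have [Eu [su hu Eu1 Eu2]] :=
  block_gap_test m V4 Y_gt0 W_ge AV (s + g) (ltn0Sn _) g_gt0 L_ge LY LD.
have d1 : dnf m W D.+1 1 (\sum_(p <- qs) a p * l.+1)
    [ffun x => all (fun G : bfun n => G x) G1].
  exists [:: G1]; split => //; first by move=> t; rewrite inE => /eqP ->.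
  by apply/ffunP => x; rewrite !ffunE /= orbF.
(* The lower bound on the sum: each clause is an OR gate in layer [D.+1], and all of them join one
   conjunction. *)
have dl : dnf m W D.+1 1 n.+1 [ffun x => all (has (fun g : bfun n => g x)) El].
  pose disj (gs : seq (bfun n)) : bfun n := [ffun x => has (fun g : bfun n => g x) gs].
  exists [:: map disj El]; split => //.
    move=> t; rewrite inE => /eqP ->; split; first by rewrite size_map.
    by move=> _ /mapP [gs /hl [sg hg] ->]; apply: layered_or.
  apply/ffunP => x; rewrite !ffunE /= orbF all_map; apply: eq_all => gs /=.
  by rewrite ffunE.
(* The upper bound: some clause of the test at threshold s + g must reject. Each rejection is an AND
   of MOD gates, and the choice of the clause goes into the outer OR. *)
have du : dnf m W D.+1 n.+1 n.+1
    [ffun x => has (fun gs => ~~ has (fun g : bfun n => g x) gs) Eu].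
  have one gs : gs \in Eu -> dnf m W D.+1 1 n.+1
      [ffun x => ~~ has (fun g : bfun n => g x) gs].
    move=> gsE; have [sg hg] := hu _ gsE.
    have [Hs [sH hH EH]] := nor_and_mod gs m1.
    pose md (H : seq (bfun n)) : bfun n :=
      [ffun x => m %| \sum_(G <- H) ((G : bfun n) x : bool)].
    exists [:: map md Hs]; split => //.
      move=> t; rewrite inE => /eqP ->; split; first by rewrite size_map.
      move=> _ /mapP [H /hH [sH' subH] ->]; apply: layered_mod.
        exact: leq_trans sH' sg.
      by move=> G /subH /hg.
    apply/ffunP => x; rewrite !ffunE EH /= orbF all_map; apply: eq_all => H /=.
    by rewrite ffunE.
  have := dnf_or (fun gs gsE => one gs gsE).
  rewrite muln1 => d; apply: (dnf_le su (leqnn _)).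
  move: d; congr dnf; apply/ffunP => x; rewrite !ffunE; apply: eq_has => gs.
  by rewrite ffunE.
have := dnf_and d1 (dnf_and dl du); rewrite !mul1n.
congr dnf; apply/ffunP => x; rewrite !ffunE E1.
apply/and3P/eqP => [[/eqP e1 al hu']|e1].
  have lt1 : s < block_sum P x + g.
    rewrite ltnNge; apply/negP => /El2; apply/negP; rewrite -all_predC.
    by apply: sub_all al => gs /=; rewrite negbK.
  have lt2 : block_sum P x < s + g.
    rewrite ltnNge; apply/negP => /Eu1 al2; move: hu' => /hasP [gs gE].
    by move/allP: al2 => /(_ _ gE) ->.
  exact: eq_of_mod lt2 lt1 e1.
split; first by rewrite e1.
- by apply: El1; rewrite e1.
- by apply: Eu2; rewrite e1.
Qed.

(** Induction on the number of blocks: guess the sum [s] of the first ones and leave t - s to the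
    last. Each block contributes at most n + 1 guesses, whence the factor [n.+1]. *)
Lemma sum_dnf k N u B (c : nat -> n.-tuple bool -> nat) :
  (forall j s, j < B -> dnf m W k N u [ffun x => c j x == s]) ->
  forall t, t <= n ->
  dnf m W k ((n.+1 * N) ^ B) (B * u) [ffun x => \sum_(0 <= j < B) c j x == t].
Proof.
elim: B => [|B IH] H t tn.
  case: t {tn} => [|t].
    have := dnf_true m W n k 0 (ltn0Sn 0); congr dnf.
    by apply/ffunP => x; rewrite !ffunE big_geq.
  have := dnf_false m W n k 1 0; congr dnf.
  by apply/ffunP => x; rewrite !ffunE big_geq.
have step s : s \in iota 0 t.+1 -> dnf m W k ((n.+1 * N) ^ B * N) (B * u + u)
    [ffun x => [ffun x => \sum_(0 <= j < B) c j x == s] x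
               && [ffun x => c B x == t - s] x].
  rewrite mem_iota add0n /= ltnS => st; apply: dnf_and.
    by apply: IH => [j s' jB|]; [apply: H; apply: ltnW|apply: leq_trans tn].
  exact: H.
have d := dnf_or step; rewrite size_iota in d.
have le1 : t.+1 * ((n.+1 * N) ^ B * N) <= (n.+1 * N) ^ B.+1.
  by rewrite expnS -mulnA [N * _]mulnC leq_mul.
have le2 : B * u + u <= B.+1 * u by rewrite mulSn addnC.
have := dnf_le le1 le2 d.
congr dnf; apply/ffunP => x; rewrite !ffunE big_nat_recr//.
apply/hasP/eqP => [[s]|E].
  rewrite mem_iota add0n !ffunE /= ltnS => st /andP [/eqP -> /eqP ->].
  by rewrite subnKC.
exists (\sum_(0 <= j < B) c j x).
  by rewrite mem_iota /= add0n ltnS -E leq_addr.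
by rewrite !ffunE eqxx /= -E addKn.
Qed.

End SymmetricDnf.

(** * Blocks as residue classes, and the choice of parameters *)

Lemma card_residue (n B j : nat) : 0 < B ->
  #|[set i : 'I_n | i %% B == j]| <= (n %/ B).+1.
Proof.
move=> B0; pose h (i : 'I_n) : 'I_(n %/ B).+1 := inord (i %/ B).
have hE i : h i = i %/ B :> nat.
  by rewrite inordK// ltnS leq_div2r// ltnW.
rewrite -[leqRHS]card_ord -(@card_in_imset _ _ h) ?max_card// => i i'.
rewrite !inE => /eqP e1 /eqP e2 /(congr1 val) /=; rewrite !hE => e3.
by apply: val_inj; rewrite /= (divn_eq i B) (divn_eq i' B) e3 e1 e2.
Qed.

Lemma sum_block_residues (n B : nat) (x : n.-tuple bool) : 0 < B ->
  \sum_(0 <= j < B) block_sum (fun i => i %% B == j) x = count id x.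
Proof.
move=> B0; rewrite /block_sum exchange_big /= -sumn_count sumnE big_map.
rewrite (big_nth false) size_tuple; apply: eq_bigr => i _.
rewrite big_mkord (bigD1 (Ordinal (ltn_pmod i B0)))//= eqxx big1 ?addn0// => j.
by rewrite -val_eqE /= eq_sym => /negbTE ->.
Qed.

Lemma layered_symmetric (R : realType) (r m l n B Lam : nat) (q : 'I_r -> nat)
    (f : n.-tuple bool -> bool) :
  0 < r -> (forall i, prime (q i)) -> injective q -> m = \prod_(i < r) q i ->
  0 < B -> B <= n.+1 -> n <= B ^ ((r + 3) * l.+1 - 1) ->
  0 < Lam -> (16 * n.+2%:R <= expR Lam%:R :> R)%R ->
  symmetric_bool f ->
  layered m ((n + m + r + l + 5) ^ (4 * (16 * m ^ l.+1 * Lam * B) + 3)) (3 * l.+1).+1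
    [ffun x => f x].
Proof.
move=> r0 q_pr q_inj mE B0 Bn nB Lam0 Lam_ge f_sym.
(* [V] dominates the small parameters, and all sizes are compared with powers of it. In [Y] the
   factor m^(l+1) pays for rounding the prime powers in [g] down, and 4 Lam for the target ratio and
   the rounded block size. *)
set V := n + m + r + l + 5; pose Y := 4 * m ^ l.+1 * Lam * B.
have XE : 16 * m ^ l.+1 * Lam * B = 4 * Y by rewrite /Y !mulnA.
rewrite XE; set X := 4 * Y; set W := V ^ _.
pose qs := [seq q i | i <- enum 'I_r].
have m0 : 0 < m by rewrite mE prodn_gt0// => i; exact: prime_gt0.
have qs_m : {in qs, forall p, p %| m}.
  by move=> _ /mapP [i _ ->]; rewrite mE (bigD1 i)//= dvdn_mulr.
have qs_pr : {in qs, forall p, prime p} by move=> _ /mapP [i _ ->].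
have qs_uniq : uniq qs by rewrite map_inj_uniq ?enum_uniq.
have m1 : 1 < m.
  have q_m : q (Ordinal r0) %| m by apply: qs_m; rewrite map_f ?mem_enum.
  exact: leq_trans (prime_gt1 (q_pr _)) (dvdn_leq m0 q_m).
have V4 : 4 <= V by rewrite /V; lia.
have V0 : 0 < V by apply: leq_trans V4.
have Y0 : 0 < Y by rewrite /Y !muln_gt0 expn_gt0 m0 Lam0 B0.
have BY : 4 * B <= Y.
  rewrite /Y -!mulnA leq_mul2l /= mulnA leq_pmull// muln_gt0 expn_gt0 m0 Lam0 //.
have BV : B <= V by rewrite (leq_trans Bn)// /V; lia.
have W_ge k : k <= 4 * X + 3 -> V ^ k <= W by move=> hk; rewrite leq_pexp2l.
pose a p := trunc_log p B.
have aB p : prime p -> p ^ a p <= B by move=> p_pr; rewrite trunc_logP// prime_gt1.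
have W_big : (X + n.+3) * V ^ (2 * X.+1) <= W.
  apply: leq_trans (W_ge (X.+1 + 2 * X.+1) _); last by lia.
  rewrite expnD leq_mul2r; apply/orP; right; rewrite expnS.
  apply: (@leq_trans (V * X.+1)); last first.
    rewrite leq_mul2l; apply/orP; right.
    by rewrite (leq_trans (ltn_expl X (ltnSn 1)))// leq_exp2r ?muln_gt0//; lia.
  by rewrite mulnS addnC leq_add//; [rewrite /V; lia|rewrite leq_pmull].
have qs_W : {in qs, forall p, p ^ a p <= W}.
  move=> p /qs_pr /aB pB; rewrite (leq_trans pB)// (leq_trans BV)//.
  by rewrite -{1}[V]expn1 W_ge//; lia.
have qs_V : {in qs, forall p, p <= V}.
  by move=> p /qs_m /(dvdn_leq m0); rewrite /V; lia.
have qs_size : {in qs, forall p, m * (n.+1 * (n.+1 * (p * p)) ^ (p ^ a p) + p) <= W}.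
  move=> p pq; have pV := qs_V p pq; have p_pr := qs_pr p pq.
  have nV : n.+1 <= V by rewrite /V; lia.
  apply: leq_trans (W_ge (3 * B + 3) _); last by rewrite /X; lia.
  rewrite addnS expnS leq_mul//; first by rewrite /V; lia.
  apply: (@leq_trans (V * V ^ (3 * B) + V)).
    rewrite leq_add// leq_mul// expnM.
    apply: (@leq_trans ((V ^ 3) ^ (p ^ a p))).
      by rewrite leq_exp2r ?expn_gt0 ?prime_gt0// !expnS expn0 muln1 !leq_mul.
    by rewrite leq_pexp2l ?expn_gt0 ?V0// aB.
  rewrite addnS expnS addn1 expnS; have : 0 < V ^ (3 * B) by rewrite expn_gt0 V0.
  by move: (V ^ _) => z z0; nia.
pose D := (3 * l).+1.
pose g := \prod_(p <- qs) p ^ (a p * l.+1).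
(* Multiply B < p^(a_p + 1) over the [r] primes, whose product is [m]. *)
have g_ge : B ^ (r * l.+1) <= g * m ^ l.+1.
  have -> : g * m ^ l.+1 = \prod_(i < r) (q i ^ (a (q i)).+1) ^ l.+1.
    rewrite /g big_map big_enum /= mE.
    rewrite (big_morph (expn^~ l.+1) (fun y z => expnMn y z _) (exp1n _)) -big_split /=.
    by apply: eq_bigr => i _; rewrite expnM -expnMn -expnSr.
  have -> : B ^ (r * l.+1) = \prod_(i < r) B ^ l.+1.
    by rewrite big_const_ord iter_muln_1 -expnM mulnC.
  apply: leq_prod => i _; rewrite leq_exp2r//.
  by apply/ltnW/trunc_log_ltn/prime_gt1.
(* The exponent of B in the hypothesis on n is D + r (l + 1) + 1, so n / B <= B^(D + r (l + 1)).
   Here B^D comes from Y^D, the rest from g m^(l+1), and 4 Lam m^(l+1) is spare in a single factor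
   Y. *)
have gap A : A <= (n %/ B).+1 -> (Lam%:R * A%:R * 2 <= Y%:R ^+ D * g%:R :> R)%R.
  move=> A_le; rewrite -natrX -!natrM ler_nat.
  have nBE : (n %/ B).+1 <= 2 * B ^ (D + r * l.+1).
    have EE : (r + 3) * l.+1 - 1 = (D + r * l.+1).+1 by rewrite /D; lia.
    rewrite EE in nB.
    have : n %/ B <= B ^ (D + r * l.+1).
      by rewrite -ltnS ltn_divLR// (leq_ltn_trans nB)// expnSr ltn_pmul2r.
    by have : 0 < B ^ (D + r * l.+1) by [rewrite expn_gt0 B0]; lia.
  apply: (@leq_trans (4 * Lam * (B ^ D * (g * m ^ l.+1)))).
    apply: (@leq_trans (4 * Lam * B ^ (D + r * l.+1))).
      move: nBE A_le; move: (B ^ _) (n %/ B).+1 => z1 z2; nia.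
    by rewrite leq_mul2l expnD leq_mul2l g_ge !orbT.
  have -> : Y = B * (4 * Lam * m ^ l.+1) by rewrite /Y; ring.
  have -> : 4 * Lam * (B ^ D * (g * m ^ l.+1)) = B ^ D * (4 * Lam * m ^ l.+1) * g by ring.
  rewrite expnMn leq_mul2r leq_mul2l -[leqLHS]expn1 leq_pexp2l ?orbT//.
  by rewrite !muln_gt0 expn_gt0 m0 Lam0.
have LY : (Lam%:R <= Y%:R :> R)%R.
  by rewrite ler_nat /Y -mulnA [Lam * B]mulnC mulnA leq_pmull// !muln_gt0 expn_gt0 m0 B0.
have blk j s : j < B -> dnf m W D.+1 n.+1
   (\sum_(p <- qs) a p * l.+1 + (n.+1 + n.+1))
   [ffun x : n.-tuple bool => block_sum (fun i => i %% B == j) x == s].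
  move=> jB; have cr := @card_residue n B j B0.
  apply: (block_exact m1 V4 Y0 W_big qs_uniq qs_pr qs_m qs_W qs_size Lam_ge LY).
    apply: (leq_trans cr); apply: (@leq_trans n.+1); first by rewrite ltnS leq_div.
    by rewrite /V; lia.
  exact: gap.
have tot := sum_dnf blk.
(* By symmetry acceptance depends on the weight [t] alone, so this is a constant for each [t];
   rejected weights give the empty disjunction. *)
pose okt t := [exists y : n.-tuple bool, (count id y == t) && f y].
have step t : t \in iota 0 n.+1 -> dnf m W D.+1 ((n.+1 * n.+1) ^ B)
   (B * (\sum_(p <- qs) a p * l.+1 + (n.+1 + n.+1)))
   [ffun x : n.-tuple bool => (\sum_(0 <= j < B) block_sum (fun i => i %% B == j) x == t) && okt t].
  rewrite mem_iota add0n /= ltnS => tn.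
  case: (okt t).
    set F := (X in dnf _ _ _ _ _ X).
    suff -> : F = [ffun x : n.-tuple bool =>
      \sum_(0 <= j < B) block_sum (fun i => i %% B == j) x == t].
      exact: tot.
    by apply/ffunP => x; rewrite !ffunE andbT.
  have := dnf_false m W n D.+1 ((n.+1 * n.+1) ^ B)
    (B * (\sum_(p <- qs) a p * l.+1 + (n.+1 + n.+1))).
  by congr dnf; apply/ffunP => x; rewrite !ffunE andbF.
have d := dnf_or step; rewrite size_iota in d.
have nV : n.+1 <= V by rewrite /V; lia.
have w1 : n.+1 * (n.+1 * n.+1) ^ B <= W.
  apply: leq_trans (W_ge (2 * B).+1 _); last by rewrite /X; lia.
  rewrite expnS leq_mul// expnM leq_exp2r// expnS expn1 leq_mul//.
have w2 : B * (\sum_(p <- qs) a p * l.+1 + (n.+1 + n.+1)) <= W.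
  apply: leq_trans (W_ge 5 _); last by rewrite /X; lia.
  have s1 : \sum_(p <- qs) a p * l.+1 <= r * (B * l.+1).
    rewrite big_map big_enum /= -[r in leqRHS]card_ord -sum_nat_const.
    apply: leq_sum => i _; rewrite leq_mul2r (leq_trans _ (aB _ (q_pr i))) ?orbT//.
    by rewrite ltnW// ltn_expl// prime_gt1.
  have rV : r <= V by rewrite /V; lia.
  have lV : l.+1 <= V by rewrite /V; lia.
  rewrite expnS leq_mul//; apply: (@leq_trans (V ^ 3 + V + V)).
    rewrite -addnA leq_add//; last by rewrite leq_add.
    apply: (leq_trans s1); rewrite !expnS expn0 muln1 !leq_mul//.
  rewrite !expnS expn0 muln1; have : 16 <= V * V by rewrite (leq_mul V4 V4).
  move: (V * V) => z z16; apply: (@leq_trans (V * (4 * z))).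
    have -> : V * z + V + V = V * (z + 2) by ring.
    by rewrite leq_mul2l; apply/orP; right; move: z16; clear; lia.
  by rewrite leq_mul2l leq_mul2r V4 !orbT.
have -> : (3 * l.+1).+1 = D.+3 by rewrite /D mulnS addnC !addnS addn0.
have := dnf_layered w1 w2 d.
congr layered; apply/ffunP => x; rewrite !ffunE; apply/hasP/idP => [[t _]|fx].
  rewrite !ffunE sum_block_residues// => /andP [/eqP xt /existsP [y /andP [/eqP yt fy]]].
  by rewrite (f_sym x y)// yt.
exists (count id x).
  rewrite mem_iota /= add0n ltnS -[leqRHS](size_tuple x); exact: count_size.
rewrite !ffunE sum_block_residues// eqxx /=.
by apply/existsP; exists x; rewrite eqxx.
Qed.

(** * Asymptotics *)

Lemma layered_size_le W k : layered_size W k <= W.+1 ^ k.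
Proof.
elim: k => //= k IH; rewrite expnS mulSn -add1n leq_add ?expn_gt0//.
by rewrite leq_mul2l IH orbT.
Qed.

Section Asymptotics.
Variable R : realType.
Local Open Scope ring_scope.

Lemma root_ceil_le (b E n : nat) : (0 < E)%N -> (b ^ E <= n)%N ->
  b%:R <= n%:R `^ (E%:R^-1) :> R.
Proof.
move=> E0 bn.
have -> : b%:R = (b ^ E)%N%:R `^ (E%:R^-1) :> R.
  rewrite natrX -powR_mulrn// -powRrM divff ?powRr1// pnatr_eq0.
  by rewrite -lt0n.
by apply: ge0_ler_powR; rewrite ?nnegrE ?invr_ge0 ?ler_nat.
Qed.

Lemma ln_affine_le (K n : nat) : (K.+2 <= n)%N -> ln (n + K)%:R <= 2 * ln n%:R :> R.
Proof.
move=> Kn; have n0 : 0 < n%:R :> R by rewrite ltr0n (leq_trans _ Kn).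
have -> : 2 * ln n%:R = ln ((n%:R : R) ^+ 2).
  by rewrite lnXn// mulr_natl.
rewrite ler_ln ?posrE ?exprn_gt0 ?ltr0n ?addn_gt0 ?(leq_trans _ Kn)//.
by rewrite -natrX ler_nat; nia.
Qed.

End Asymptotics.

Theorem theorem1p4 (R : realType) (r m d : nat) (q : 'I_r -> nat)
    (r_gt0 : (0 < r)%N)
    (q_prime : forall i, prime (q i))
    (q_inj : injective q)
    (m_def : m = (\prod_(i < r) q i)%N)
    (m_good : good m)
    (d_ge4 : (4 <= d)%N)
    (d_mod3 : d = 1 %[mod 3]) :
  exists g : nat -> R,
    soft_bigO g
      (fun n => (n%:R `^ (3 / ((r%:R + 3) * (d%:R - 1) - 3)))%R) /\
    forall (n : nat) (f : n.-tuple bool -> bool), symmetric_bool f ->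
      exists C : circuit n,
        [/\ circuit_depth C = d,
            computes m C f &
            ((circuit_size C)%:R <= expR (g n))%R].
Proof.
have [l dE] : exists l, d = (3 * l.+1).+1.
  exists ((d - 4) %/ 3); have := divn_eq d 3; rewrite d_mod3 modn_small//.
  by move: d_ge4; lia.
pose E := (r + 3) * l.+1 - 1.
have E0 : 0 < E by rewrite /E; lia.
have B_ex n : exists b, (0 < b) && (n <= b ^ E).
  by exists n.+1; rewrite /= (leq_trans (leqnSn n))// -[leqLHS]expn1 leq_pexp2l.
(* The ceiling of n^(1/E), forced to be positive also at n = 0. *)
pose B n := ex_minn (B_ex n).
pose Lam n := (Num.truncn (ln (16 * n.+2%:R) : R)%R).+1.
pose X n := 16 * m ^ l.+1 * Lam n * B n.
pose V n := n + m + r + l + 5.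
(* The circuit has at most 2 W^(2 d) <= W^(2 d + 1) gates for W = V^(4 X + 3); this is the logarithm
   of that bound. *)
exists (fun n => (((4 * X n + 3) * (2 * d).+1)%N%:R * ln (V n)%:R)%R); split; last first.
  move=> n f f_sym.
  have [B1 B2 B3] : [/\ 0 < B n, n <= B n ^ E & B n <= n.+1].
    rewrite /B; case: ex_minnP => b /andP [b0 nb] bmin; split => //.
    by apply: bmin; rewrite /= (leq_trans (leqnSn n))// -[leqLHS]expn1 leq_pexp2l.
  have Lam_ge : (16 * n.+2%:R <= expR (Lam n)%:R :> R)%R.
    rewrite -[leLHS]lnK ?posrE ?mulr_gt0 ?ltr0n// ler_expR ltW//.
    exact: truncnS_gt.
  have HL := layered_symmetric r_gt0 q_prime q_inj m_def B1 B3 B2 (ltn0Sn _) Lam_ge f_sym.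
  rewrite -dE -/(X n) -/(V n) in HL.
  set W := V n ^ _ in HL.
  have V2 : 2 <= V n by rewrite /V; lia.
  have W2 : 2 <= W.
    by rewrite (leq_trans V2)// -[leqLHS]expn1 leq_pexp2l// ?(leq_trans _ V2)// addn3.
  have d0 : 0 < d by apply: leq_trans d_ge4.
  have [C [C1 C2 C3]] := layered_circuit (ltnW W2) HL d0.
  exists C; split => //; first by move=> x; rewrite C2 ffunE.
  rewrite expRM_natl lnK; last by rewrite posrE ltr0n (leq_trans _ V2).
  rewrite -natrX ler_nat expnM -/W (leq_trans C3)//.
  have s1 : layered_size W d <= W ^ (2 * d).
    rewrite (leq_trans (layered_size_le W d))// expnM leq_exp2r// expnS expn1.
    by rewrite (leq_trans _ (leq_mul W2 (leqnn W)))// mul2n -addnn; lia.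
  have s2 : d <= W ^ (2 * d).
    rewrite (leq_trans (ltnW (ltn_expl d W2)))// leq_pexp2l ?leq_pmull//.
    exact: ltnW.
  rewrite (leq_trans (leq_add s1 s2))// expnS addnn -mul2n leq_mul2r W2 orbT.
  by [].
have M0 : 0 < m by rewrite m_def prodn_gt0// => i; exact: prime_gt0.
(* Since d - 1 = 3 (l + 1), the denominator is 3 E. *)
have eE : (3 / ((r%:R + 3) * (d%:R - 1) - 3) = E%:R^-1 :> R)%R.
  have -> : (d%:R - 1 = 3 * l.+1%:R :> R)%R by rewrite dE -natr1 natrM addrK.
  have EE : (E%:R = (r%:R + 3) * l.+1%:R - 1 :> R)%R.
    by rewrite /E natrB ?natrM ?natrD// muln_gt0 addn_gt0 orbT.
  have -> : ((r%:R + 3) * (3 * l.+1%:R) - 3 = 3 * E%:R :> R)%R by rewrite EE; ring.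
  by rewrite invfM mulrA divff// mul1r.
(* One logarithm comes from [Lam n], the other from [ln (V n)]. *)
exists 2; rewrite eE; apply/eqO_exP.
pose K := m + r + l + 5.
(* 384 = 4 16 3 2, from 4 X, the 16 in X, Lam <= 3 ln n and B <= 2 n^(1/E); the final 2 is from ln V
   <= 2 ln n. *)
exists ((384 * m ^ l.+1 + 3) * (2 * d).+1 * 2)%N%:R%R.
  by rewrite /= ltr0n !muln_gt0 addn_gt0 orbT.
(* This ensures n + K <= n^2, 16 (n + 2) <= n^2 and ln n >= 1. *)
exists (K + 22) => // n /= n_ge.
have n20 : 22 <= n by apply: leq_trans n_ge; rewrite leq_addl.
have nK : K.+2 <= n by apply: leq_trans n_ge; rewrite -addn2 leq_add2l.
have nR : (22 <= n%:R :> R)%R by rewrite (ler_nat _ 22).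
have n0 : (0 < n%:R :> R)%R by lra.
have VE : V n = n + K by rewrite /V /K !addnA.
have lnV := ln_affine_le R nK; rewrite -VE in lnV.
set t := ln (n%:R : R)%R in lnV *.
have t1 : (1 <= t)%R.
  rewrite /t -ler_expR lnK ?posrE//; have := expR1_le4 R; lra.
set z := (n%:R `^ E%:R^-1)%R.
have z1 : (1 <= z)%R.
  by apply: (@root_ceil_le R 1) => //; rewrite exp1n (leq_trans _ n20).
(* By minimality (B - 1)^E < n unless B = 1, so B <= z + 1 <= 2 z. *)
have B_le : ((B n)%:R <= 2 * z :> R)%R.
  rewrite /B; case: ex_minnP => -[|b] // _ bmin.
  have [b0|b_gt0] := posnP b; first by rewrite b0; lra.
  have lt_b : b ^ E < n.
    rewrite ltnNge; apply/negP => nb; have := bmin b; rewrite b_gt0 nb => /(_ isT).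
    by rewrite ltnn.
  have := root_ceil_le R E0 (ltnW lt_b); rewrite -/z -natr1; lra.
have Lam_le : ((Lam n)%:R <= 3 * t :> R)%R.
  have l0 : (0 <= ln (16 * n.+2%:R) :> R)%R.
    by apply: ln_ge0; rewrite -natrM (ler_nat _ 1).
  have := truncn_le (ln (16 * n.+2%:R) : R)%R; rewrite l0 => tr.
  have h : (ln (16 * n.+2%:R) <= 2 * t :> R)%R.
    have -> : (2 * t = ln ((n%:R : R) ^+ 2))%R by rewrite lnXn// mulr_natl.
    rewrite ler_ln ?posrE ?exprn_gt0 ?mulr_gt0//.
    by rewrite -natrX -natrM ler_nat; move: n20; clear; nia.
  have -> : ((Lam n)%:R = (Num.truncn (ln (16 * n.+2%:R) : R))%:R + 1 :> R)%R.
    by rewrite natr1.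
  lra.
have lnV0 : (0 <= ln (V n)%:R :> R)%R.
  by apply: ln_ge0; rewrite (ler_nat _ 1) /V; lia.
rewrite /= ger0_norm ?mulr_ge0// ger0_norm ?mulr_ge0 ?exprn_ge0//; try lra.
set c := (m ^ l.+1)%N.
have X_le : ((4 * X n + 3)%N%:R <= (384 * c + 3)%N%:R * (t * z) :> R)%R.
  rewrite !natrD /X !natrM -/c.
  have tz : (1 <= t * z)%R by nra.
  have LB : ((Lam n)%:R * (B n)%:R <= (3 * t) * (2 * z) :> R)%R by rewrite ler_pM.
  have c0 : (0 <= c%:R :> R)%R by [].
  have := ler_wpM2l c0 LB; nra.
rewrite !natrM; set A := (384 * c + 3)%N%:R%R in X_le *.
have A0 : (0 <= A)%R by [].
have dd : (0 <= (2 * d).+1%:R :> R)%R by [].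
apply: (@le_trans _ _ ((A * (t * z) * (2 * d).+1%:R) * (2 * t))%R).
  by rewrite ler_pM ?mulr_ge0// ler_wpM2r.
by rewrite le_eqVlt; apply/orP; left; apply/eqP; ring.
Qed.
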